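(* Let integers $p_0\ge1$, $m,K_0\ge1$ be given, $d=p_0+m$, and let $h_0$ be a link function (of ARX type, i.e. not depending on past conditional means) which determines the statistic $\Delta_{T,W}$ as in the context. Assume the following. (1) $h_0:[0,\infty)^{p_0}\times\mathbb R^{m+K_0}\to(c_h,\infty)$ for some $c_h>0$, and $h_0(y,x;\theta)=r_0(y;\theta)+\pi_0(x;\theta)$ with continuous $r_0:[0,\infty)^{p_0}\times\mathbb R^{K_0}\to(0,\infty)$, $\pi_0:\mathbb R^{m+K_0}\to(0,\infty)$. The set $\Theta\subset\mathbb R^{K_0}$ is such that, for some constants $\alpha_1,\dots,\alpha_{p_0}$ with $\sum_{i=1}^{p_0}\alpha_i<1$, $|r_0(y_1;\theta)-r_0(y_2;\theta)|\le\sum_{i=1}^{p_0}\alpha_i|y_{1i}-y_{2i}|$ for all $\theta\in\Theta$, $y_1,y_2\in[0,\infty)^{p_0}$. (2) The true model has the same family $\{\mathcal F_\lambda\}$ but a different link function $h_A:[0,\infty)^{p_A+q_A}\times\mathbb R^{m+K_A}\to(0,\infty)$ with arbitrary integers $p_A\ge1$, $q_A\ge0$, $K_A\ge1$: $\{X_t\}$ is strictly stationary and ergodic, $\{\mathcal F_\lambda\}$ satisfies the stochastic order condition of the context, and $\{(Y_t,\lambda_{t,A})\}$ is the stationary and ergodic solution of $Y_t|\mathcal I_{t-1}\sim\mathcal F_{\lambda_{t,A}}$, $\lambda_{t,A}=h_A(Z_{t,A};\theta_A)$, $Z_{t,A}=(Y_{t-1},\dots,Y_{t-p_A},\lambda_{t-1,A},\dots,\lambda_{t-q_A,A},X_{t-1}^\top)^\top$,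 where $\theta_A\in\mathbb R^{K_A}$ is an interior point of a compact parameter set; and $\mathbb E\|Z_{t,A}\|^2<\infty$. (3) For some $M_1>0$, $|\partial g_\lambda(u)/\partial\lambda|<M_1$ for all $u\in[0,1]$, $\lambda\in(0,\infty)$. (4) There exists $\theta_0\in\mathrm{int}(\Theta_0)$, with $\Theta_0$ a compact subset of $\Theta$, such that $\widehat\theta_T\to\theta_0$ in probability as $T\to\infty$. (5) $W(u,v)=w(u)\omega(v)$ for measurable $w:(0,1)\to(0,\infty)$ and $\omega:\mathbb R^d\to(0,\infty)$ with $\omega(v)=\omega(-v)$ for all $v$, $0<\int_0^1w(u)\,du<\infty$ and $0<\int_{\mathbb R^d}\omega(v)\,dv<\infty$. (6) There is a neighborhood $\mathcal V(\theta_0)$ of $\theta_0$ such that, with $\mathbf Y=(Y_{t-1},\dots,Y_{t-p_0})^\top$, $$\mathbb E\sup_{\theta\in\mathcal V(\theta_0)}|h_0(\mathbf Y,X_{t-1};\theta)|<\infty,\qquad \mathbb E\sup_{\theta\in\mathcal V(\theta_0)}\Big\|\frac{\partial h_0(\mathbf Y,X_{t-1};\theta)}{\partial\theta}\Big\|<\infty .$$ Then, as $T\to\infty$, $$\frac1T\Delta_{T,W}\ \xrightarrow{\ P\ }\ \int_0^1\int_{\mathbb R^d}\zeta^2(u,v)\,w(u)\omega(v)\,dv\,du,$$ where $$\zeta(u,v)=\mathbb E\big\{[g_{\lambda_{1,A}}(u)-g_{\lambda_{1,0}}(u)]\,\alpha(Z_{1,0},v)\big\},\qquad \lambda_{1,0}=h_0((Y_0,\dots,Y_{1-p_0})^\top,X_0;\theta_0),$$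 $Z_{t,0}=(Y_{t-1},\dots,Y_{t-p_0},X_{t-1}^\top)^\top$, and $\alpha(a,b)=\cos(a^\top b)+\sin(a^\top b)$ for $a,b\in\mathbb R^d$.
   Context: $\{Y_t\}$ is a time series with values in $\mathbb N_0$, $\{X_t\}$ is an $\mathbb R^m$-valued series of exogenous covariates, and $\mathcal I_t$ is the information ($\sigma$-field) generated by $(Y_s,X_s)$, $s\le t$. $\{\mathcal F_\lambda,\lambda>0\}$ is a family of distributions on $\mathbb N_0$, $\mathcal F_\lambda$ having mean $\lambda$; the stochastic order condition is: $\lambda_1\le\lambda_2$ implies $\mathcal F_{\lambda_1}(y)\ge\mathcal F_{\lambda_2}(y)$ for all $y\in\mathbb R$ (distribution functions). $g_\lambda(u)=\sum_{k\ge0}u^k\mathcal F_\lambda(\{k\})$, $u\in[0,1]$, is the probability generating function of $\mathcal F_\lambda$. Stationary and ergodic solution means that the joint process $\{(Y_t,\lambda_{t,A},X_t)\}$ is strictly stationary and ergodic. Test statistic (for the hypothesis that the link is $h_0(\cdot;\theta)$ for some $\theta\in\mathrm{int}(\Theta_0)$). Data $(Y_t,X_{t-1})$, $t=1,\dots,T$, are observed and $\widehat\theta_T$ is a $\Theta$-valued estimator computed from them. With some fixed nonnegative initial values for $Y_t$, $t\le0$, put for $t=1,\dots,T$: $\widehat Z_{t}=(Y_{t-1},\dots,Y_{t-p_0},X_{t-1}^\top)^\top$, $\widehat\lambda_t=h_0(\widehat Z_t;\widehat\theta_T)$, $\widehat\varepsilon_t(u)=u^{Y_t}-g_{\widehat\lambda_t}(u)$,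 $D_T(u;v)=\frac1T\sum_{t=1}^T\widehat\varepsilon_t(u)e^{\mathrm i v^\top\widehat Z_t}$ ($\mathrm i=\sqrt{-1}$), and $\Delta_{T,W}=T\int_0^1\int_{\mathbb R^d}|D_T(u;v)|^2W(u,v)\,dv\,du$. (The initial values are used only in the statistic; $\zeta$ is defined with the stationary variables.) *)

(* Defs.v *)
From HB Require Import structures.
From mathcomp Require Import all_boot all_order all_algebra.
From mathcomp Require Import all_classical all_reals all_analysis.
From mathcomp.real_closed Require Import complex.

Set Implicit Arguments.
Unset Strict Implicit.
Unset Printing Implicit Defensive.

Import Order.TTheory GRing.Theory Num.Theory numFieldNormedType.Exports.

Local Open Scope classical_set_scope.
Local Open Scope ring_scope.

(** The product sigma-algebra on matrices, generated by the entries: the same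
    choice as the library makes for [n.-tuple T]. For [R : realType] it is the
    Borel sigma-algebra of ['M[R]_(m, n)]. *)

Definition measure_matrix_display : measure_display -> measure_display.
Proof. exact. Qed.

Definition matrix_cylinders d (T : measurableType d) m n : set (set 'M[T]_(m, n)) :=
  [set C | exists i j, exists2 B : set T, measurable B & C = [set M : 'M[T]_(m, n) | B (M i j)]].

Section measurable_matrix.
Context d (T : measurableType d) (m n : nat).

Let matrix_set0 : <<s @matrix_cylinders d T m n >> set0.
Proof. exact: sigma_algebra0. Qed.

Let matrix_setC A : <<s @matrix_cylinders d T m n >> A ->
  <<s @matrix_cylinders d T m n >> (~` A).
Proof. exact: sigma_algebraC. Qed.

Let matrix_bigcup (F : (set 'M[T]_(m, n))^nat) :
  (forall i, <<s @matrix_cylinders d T m n >> (F i)) ->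
  <<s @matrix_cylinders d T m n >> (\bigcup_i F i).
Proof. exact: sigma_algebra_bigcup. Qed.

HB.instance Definition _ := @isMeasurable.Build (measure_matrix_display d)
  'M[T]_(m, n) <<s @matrix_cylinders d T m n >>
  matrix_set0 matrix_setC matrix_bigcup.

End measurable_matrix.

Lemma measurable_entry d (T : measurableType d) m n (i : 'I_m) (j : 'I_n) :
  measurable_fun setT (fun M : 'M[T]_(m, n) => M i j).
Proof.
move=> _ B mB; rewrite setTI; apply: sub_sigma_algebra.
by exists i, j, B.
Qed.

Lemma measurable_matrixP d (T : measurableType d) m n d' (U : measurableType d')
    (f : U -> 'M[T]_(m, n)) :
  (forall i j, measurable_fun setT (fun x => f x i j)) -> measurable_fun setT f.
Proof.
move=> mf; apply: (@measurability _ _ _ _ _ _ (@matrix_cylinders d T m n)) => //.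
move=> _ [_ [i [j [B mB ->]]] <-]; rewrite setTI.
by have := mf i j measurableT _ mB; rewrite setTI.
Qed.

Section lebesgue_rV.
Context {R : realType}.

Definition rV_cons n (z : R * 'rV[R]_n) : 'rV[R]_n.+1 :=
  \row_i oapp (z.2 0) z.1 (unlift ord0 i).

Lemma rV_cons0 n (z : R * 'rV[R]_n) : rV_cons z 0 0 = z.1.
Proof. by rewrite mxE unlift_none. Qed.

Lemma rV_consS n (z : R * 'rV[R]_n) i : rV_cons z 0 (lift ord0 i) = z.2 0 i.
Proof. by rewrite mxE liftK. Qed.

Lemma measurable_rV_cons n : measurable_fun setT (@rV_cons n).
Proof.
apply: measurable_matrixP => i j; rewrite (ord1 i).
case: (unliftP ord0 j) => [k ->|->].
  under eq_fun do rewrite rV_consS.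
  exact: (measurableT_comp (measurable_entry _ _) measurable_snd).
under eq_fun do rewrite rV_cons0.
exact: measurable_fst.
Qed.

Section step.
Variables (n : nat) (mu : {sigma_finite_measure set 'rV[R]_n -> \bar R}).

Definition lebesgue_rV_step : set 'rV[R]_n.+1 -> \bar R :=
  pushforward (@lebesgue_measure R \x mu)%E (@rV_cons n).

Let lebesgue_rV_step0 : lebesgue_rV_step set0 = 0%E.
Proof. by rewrite /lebesgue_rV_step /pushforward preimage_set0 measure0. Qed.

Let lebesgue_rV_step_ge0 A : (0 <= lebesgue_rV_step A)%E.
Proof. exact: integral_ge0. Qed.

Let lebesgue_rV_step_sigma_additive : semi_sigma_additive lebesgue_rV_step.
Proof.
exact: (@measure_semi_sigma_additive _ _ _
  (@measure_function_pushforward__canonical__measure_function_Measure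
     _ _ _ _ R (@lebesgue_measure R \x mu)%E _ (@measurable_rV_cons n))).
Qed.

HB.instance Definition _ := isMeasure.Build _ _ _ lebesgue_rV_step
  lebesgue_rV_step0 lebesgue_rV_step_ge0 lebesgue_rV_step_sigma_additive.

Let lebesgue_rV_step_sigma_finite : sigma_finite setT lebesgue_rV_step.
Proof.
have /sigma_finiteP[F [TF ndF mF]] := sigma_finiteT (@lebesgue_measure R).
have /sigma_finiteP[G [TG ndG mG]] := sigma_finiteT mu.
pose g (v : 'rV[R]_n.+1) : R * 'rV[R]_n := (v 0 0, \row_i v 0 (lift ord0 i)).
have consK : cancel (@rV_cons n) g.
  case=> x v; rewrite /g rV_cons0; congr pair.
  by apply/rowP => i; rewrite mxE rV_consS.
have mg : measurable_fun setT g.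
  apply/measurable_fun_pairP; split; first exact: measurable_entry.
  apply: measurable_matrixP => i j /=.
  under eq_fun do rewrite mxE.
  exact: measurable_entry.
exists (fun k => g @^-1` (F k `*` G k)).
  rewrite -preimage_bigcup -(preimage_setT g); congr (_ @^-1` _).
  apply/seteqP; split => [[x v] _|//].
  have [i _ Fix] : (\bigcup_k F k) x by rewrite -TF.
  have [j _ Gjv] : (\bigcup_k G k) v by rewrite -TG.
  exists (maxn i j) => //; split.
    by move: Fix; apply/subsetPset/ndF/leq_maxl.
  by move: Gjv; apply/subsetPset/ndG/leq_maxr.
move=> k; have [mFk Fk] := mF k; have [mGk Gk] := mG k.
have mFG : measurable (F k `*` G k) by exact: measurableX.
split; first by rewrite -[X in measurable X]setTI; exact: mg.
rewrite /= /lebesgue_rV_step /pushforward.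
rewrite (_ : _ @^-1` _ = F k `*` G k); last first.
  by apply/seteqP; split => z; rewrite /preimage /mkset consK.
by rewrite product_measure1E// lte_mul_pinfty// ge0_fin_numE.
Qed.

HB.instance Definition _ := Measure_isSigmaFinite.Build _ _ _ lebesgue_rV_step
  lebesgue_rV_step_sigma_finite.

End step.

Fixpoint lebesgue_rV (n : nat) : {sigma_finite_measure set 'rV[R]_n -> \bar R} :=
  if n is n'.+1 then lebesgue_rV_step (lebesgue_rV n') else \d_(0 : 'rV[R]_0).

Lemma lebesgue_rV_box n (a b : 'rV[R]_n) : (forall i, a 0 i <= b 0 i) ->
  lebesgue_rV n [set v | forall i, v 0 i \in `[a 0 i, b 0 i]] =
  (\prod_i (b 0 i - a 0 i))%:E.
Proof.
elim: n a b => [a b _|n IH a b ab].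
  rewrite big_ord0 /= diracE mem_set//= => -[] //.
pose a' : 'rV[R]_n := \row_i a 0 (lift ord0 i).
pose b' : 'rV[R]_n := \row_i b 0 (lift ord0 i).
have IHab := IH a' b'.
rewrite big_ord_recl; set S := [set v | _].
pose S' := [set v : 'rV[R]_n | forall i, v 0 i \in `[a' 0 i, b' 0 i]].
have SE : @rV_cons n @^-1` S = `[a 0 0, b 0 0]%classic `*` S'.
  apply/seteqP; split=> -[x v].
    move=> H; split; first by have := H 0; rewrite rV_cons0.
    by move=> i; have := H (lift ord0 i); rewrite rV_consS !mxE.
  case=> /= xab vab i; case: (unliftP ord0 i) => [k ->|->].
    by rewrite rV_consS; have := vab k; rewrite !mxE.
  by rewrite rV_cons0.
have mS' : measurable S'.
  rewrite (_ : S' =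
      \bigcap_(i : 'I_n) (fun v : 'rV[R]_n => v 0 i) @^-1` `[a' 0 i, b' 0 i]%classic).
    apply: fin_bigcap_measurable => // i _.
    by rewrite -[X in measurable X]setTI; exact: measurable_entry.
  by apply/seteqP; split=> v vab i; [move=> _|]; exact: vab.
transitivity
    ((@lebesgue_measure R \x lebesgue_rV n)%E (`[a 0 0, b 0 0]%classic `*` S')).
  by rewrite -SE.
rewrite product_measure1E// IHab; last by move=> i; rewrite !mxE.
under eq_bigr do rewrite !mxE.
rewrite [X in (X * _)%E](_ : _ = (b 0 0 - a 0 0)%:E) -?EFinM//.
rewrite [LHS]lebesgue_measure_itv/= lte_fin.
case: ltP => [_|ba]; first by rewrite -EFinB.
have -> : b 0 0 = a 0 0 by apply/le_anti; rewrite ba ab.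
by rewrite subrr.
Qed.

End lebesgue_rV.

(** The library norm on ['rV[R]_n] is the sup norm, hence the explicit
    Euclidean one. *)
Definition enorm (R : realType) n (v : 'rV[R]_n) : R :=
  Num.sqrt (\sum_i v 0 i ^+ 2).

Definition dotv (R : realType) n (a b : 'rV[R]_n) : R := (a *m b^T) 0 0.

Definition cvg_in_probability d (T : measurableType d) (R : realType)
    (P : probability T R) (V : normedModType R) (Z : nat -> T -> V) (z : V) : Prop :=
  forall eps : R, 0 < eps ->
    (fun n => P [set x | eps <= `|Z n x - z|]) @ \oo --> 0%E.

(** Strict stationarity and ergodicity of a process indexed by the integers, as
    properties of its law on the path space with the product sigma-algebra and
    the shift. *)
Section stationary_ergodic.
Context d (T : measurableType d) (R : realType) (P : probability T R).
Context dE (E : measurableType dE).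

Definition path_measurable : set (set (int -> E)) :=
  <<s [set C | exists t, exists2 A : set E, measurable A &
        C = [set w : int -> E | A (w t)]] >>.

Definition shift_path (w : int -> E) : int -> E := fun t => w (t + 1).

Definition sample_path (Z : int -> T -> E) (x : T) : int -> E := fun t => Z t x.

Definition strictly_stationary (Z : int -> T -> E) : Prop :=
  forall A, path_measurable A ->
    P (sample_path Z @^-1` (shift_path @^-1` A)) = P (sample_path Z @^-1` A).

Definition ergodic (Z : int -> T -> E) : Prop :=
  forall A, path_measurable A -> shift_path @^-1` A = A ->
    P (sample_path Z @^-1` A) = 0%E \/ P (sample_path Z @^-1` A) = 1%E.

End stationary_ergodic.

(** The sigma-field generated by [(Y_s, X_s)], [s <= t]. *)
Definition information d (T : measurableType d) (R : realType) m
    (Y : int -> T -> nat) (X : int -> T -> 'rV[R]_m) (t : int) : set (set T) :=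
  <<s [set C | exists2 s, s <= t & exists2 A : set (nat * 'rV[R]_m), measurable A &
        C = [set x | A (Y s x, X s x)]] >>.

(** [Y | G ~ F_lam]: the kernel [x |-> F (lam x)] is [G]-measurable and is a
    regular conditional distribution of [Y] given [G]. *)
Definition conditional_law d (T : measurableType d) (R : realType)
    (P : probability T R) (Y : T -> nat) (G : set (set T))
    (F : R -> probability nat R) (lam : T -> R) : Prop :=
  (forall B : set R, measurable B -> G (lam @^-1` B)) /\
  (forall (A : set nat) (B : set T), G B ->
     P ([set x | A (Y x)] `&` B) = \int[P]_(x in B) F (lam x) A)%E.

Definition stochastic_order (R : realType) (F : R -> probability nat R) : Prop :=
  forall l1 l2 : R, 0 < l1 -> l1 <= l2 -> forall y : R,
    (F l2 [set k | k%:R <= y]%R <= F l1 [set k | k%:R <= y]%R)%E.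

Definition has_mean_parameter (R : realType) (F : R -> probability nat R) : Prop :=
  forall l : R, 0 < l -> (\int[F l]_k (k%:R)%:E = l%:E)%E.

Definition pgf (R : realType) (F : R -> probability nat R) (l u : R) : R :=
  fine (\sum_(0 <= k <oo) (u ^+ k)%:E * F l [set k])%E.

(** [(z_{t-1}, ..., z_{t-p})]. *)
Definition lags (R : realType) p (z : int -> R) (t : int) : 'rV[R]_p :=
  \row_(i < p) z (t - i.+1%:Z).

Definition count_path T (R : realType) (Y : int -> T -> nat) (x : T) : int -> R :=
  fun t => (Y t x)%:R.

Definition nonneg_rV (R : realType) n (y : 'rV[R]_n) : Prop := forall i, 0 <= y 0 i.

(** A link function [h (y, x; theta)]; [n] is the number of lagged arguments. *)
Definition link (R : realType) n m K : Type :=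
  'rV[R]_n -> 'rV[R]_m -> 'rV[R]_K -> R.

Definition theta_derivable (R : realType) n m K (h : link R n m K)
    (y : 'rV[R]_n) (x : 'rV[R]_m) (theta : 'rV[R]_K) : Prop :=
  forall j, derivable (h y x) theta (delta_mx 0 j).

Definition theta_gradient (R : realType) n m K (h : link R n m K)
    (y : 'rV[R]_n) (x : 'rV[R]_m) (theta : 'rV[R]_K) : 'rV[R]_K :=
  \row_j 'D_(delta_mx 0 j) (h y x) theta.

(** The test statistic along one realisation: [y], [xi] are the paths of [Y] and
    [X] (only [y_1, ..., y_N] and [xi_0, ..., xi_{N-1}] are used), [init] holds
    the initial values for times [t <= 0] and [theta] is the estimate. *)
Section test_statistic.
Context (R : realType) (p m K : nat) (h : link R p m K).
Variables (F : R -> probability nat R) (init : int -> R).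
Variables (y : int -> nat) (xi : int -> 'rV[R]_m) (theta : 'rV[R]_K) (N : nat).

Definition observed (t : int) : R := if 1 <= t then (y t)%:R else init t.

Definition Z_hat (t : int) : 'rV[R]_(p + m) := row_mx (lags p observed t) (xi (t - 1)).

Definition lambda_hat (t : int) : R := h (lags p observed t) (xi (t - 1)) theta.

Definition eps_hat (t : int) (u : R) : R := u ^+ y t - pgf F (lambda_hat t) u.

Definition D_stat (u : R) (v : 'rV[R]_(p + m)) : R[i] :=
  ((N%:R^-1)%:C * \sum_(1 <= t < N.+1)
     (eps_hat t%:Z u)%:C * (cos (dotv v (Z_hat t%:Z)) +i* sin (dotv v (Z_hat t%:Z))))%C.

Definition Delta_stat (W : R -> 'rV[R]_(p + m) -> R) : R :=
  N%:R * \int[@lebesgue_measure R]_(u in `]0, 1[)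
           \int[lebesgue_rV (p + m)]_v (Normc.normc (D_stat u v) ^+ 2 * W u v).

End test_statistic.

(** An estimator is a family of functions of the data
    [(Y_1, X_0), ..., (Y_N, X_{N-1})]. *)
Definition estimate T (R : realType) m K
    (est : forall N, N.-tuple (nat * 'rV[R]_m) -> 'rV[R]_K)
    (Y : int -> T -> nat) (X : int -> T -> 'rV[R]_m) (N : nat) (x : T) : 'rV[R]_K :=
  est N [tuple (Y i.+1%:Z x, X i%:Z x) | i < N].

(** Cosine plus sine, so that [zeta ^ 2] integrates against an even weight to the
    squared modulus of the Fourier version used in [D_stat]. *)
Definition cas (R : realType) n (a b : 'rV[R]_n) : R := cos (dotv a b) + sin (dotv a b).

Definition zeta d (T : measurableType d) (R : realType) (P : probability T R)
    p m K (h : link R p m K) (F : R -> probability nat R) (Y : int -> T -> nat)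
    (lam : int -> T -> R) (X : int -> T -> 'rV[R]_m) (theta : 'rV[R]_K)
    (u : R) (v : 'rV[R]_(p + m)) : R :=
  let y x := lags p (count_path R Y x) 1 in
  fine (expectation P (fun x =>
    (pgf F (lam 1 x) u - pgf F (h (y x) (X 0 x) theta) u) *
    cas (row_mx (y x) (X 0 x)) v)).

(* Main.v *)
(** Proof idea. Write the squared modulus of [D_T] as the sum of the squares of its
    cosine and sine parts, each an average of terms bounded by [1]. The terms with
    [t > p0] do not see the initial values, and there the estimated intensity is close
    to the one computed with [theta0], uniformly while [(Y, X)] stays in a compact box:
    [h0] is continuous and generating functions are Lipschitz in the intensity. By
    stationarity the expected frequency of leaving the box is small. Hence the averages
    may be replaced, up to a small expected error and uniformly in [(u, v)], by ergodic
    averages of a stationary process, which converge in [L1] for each [(u, v)] (Birkhoff,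
    through the maximal ergodic lemma). Bounded convergence and Tonelli carry this over
    to the weighted integral, and Markov's inequality gives convergence in probability.
    The limits [a], [b] of the cosine and sine parts add up to [zeta], because the
    conditional mean of [u ^ Y_1] given the past is the generating function at
    [lambda_{1,A}]. Finally [a b] is odd in [v] and the weight even, so that
    [a ^ 2 + b ^ 2] and [zeta ^ 2] have the same integral. *)

Require Import Defs.
From HB Require Import structures.
From mathcomp Require Import all_boot all_order all_algebra.
From mathcomp Require Import all_classical all_reals all_analysis.
From mathcomp Require Import measurable_realfun.
From mathcomp Require Import ring lra zify.
From mathcomp.real_closed Require Import complex.

Set Implicit Arguments.
Unset Strict Implicit.
Unset Printing Implicit Defensive.

Import Order.TTheory GRing.Theory Num.Theory numFieldNormedType.Exports.

Local Open Scope classical_set_scope.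
Local Open Scope ring_scope.

(** Fourier terms are bounded by [1] whatever the intensity, so the delicate points are uniformity
    and measurability. The bound comparing estimated with stationary averages is free of [(u, v)],
    hence integrates against the finite weight to a multiple of itself. Only the event that the
    estimate is far from [theta0] is discarded: in a long sample some observations may leave any
    fixed box, so that this cannot be treated as one rare event, whereas its expected frequency is
    the same for every sample size.

    Measurability of [F l] in [l] is not given; the stochastic order supplies it, since it makes
    distribution functions monotone in [l]. The link is continuous only for nonnegative lags, and
    the sigma-algebra on vectors is generated by the entries; compositions are therefore
    approximated by rounding the arguments down to a grid, which preserves nonnegativity.

    Ergodicity is stated for sets of paths equal to their preimage under the shift, so the ergodic
    argument has to produce sets that are invariant exactly and not merely almost surely. *)

Section bounded_integrals.
Context d (T : measurableType d) (R : realType) (P : probability T R).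

Lemma bounded_integrable (f : T -> R) (C : R) : measurable_fun setT f ->
  (forall x, `|f x| <= C) -> P.-integrable setT (EFin \o f).
Proof.
move=> mf fC; apply: measurable_bounded_integrable => //.
  by rewrite [ltLHS](probability_setT P) ltry.
by exists C; split; [exact: num_real|move=> M CM x _ /=; exact: le_trans (fC x) (ltW CM)].
Qed.

Lemma Rintegral_cstT (r : R) : \int[P]_x r = r.
Proof. by rewrite Rintegral_cst// [X in fine X](probability_setT P) mulr1. Qed.

Lemma bounded_Rintegral_cvg0 (f : nat -> T -> R) (C : R) :
  (forall n, measurable_fun setT (f n)) -> (forall n x, `|f n x| <= C) ->
  {ae P, forall x, f ^~ x @ \oo --> 0} ->
  \int[P]_x `|f n x| @[n --> \oo] --> 0.
Proof.
move=> mf fC f0.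
have mEf n : measurable_fun setT (EFin \o f n) by exact/measurable_EFinP.
have f0E : {ae P, forall x, setT x -> (EFin \o f n) x @[n --> \oo] --> 0%E}.
  by apply: filterS f0 => x fx _; apply: cvg_EFin => //; exact: nearW.
have fCE : {ae P, forall x n, setT x -> (`|(EFin \o f n) x| <= cst C%:E x)%E}.
  by apply: aeW => x n _; rewrite lee_fin.
have [_ h _] := dominated_convergence measurableT mEf (measurable_cst _) f0E
  (finite_measure_integrable_cst P C measurableT) fCE.
have {}h : (\int[P]_x `|(f n x)%:E|)%E @[n --> \oo] --> 0%E.
  apply: cvg_trans h; apply: near_eq_cvg; apply: nearW => n /=.
  by apply: eq_integral => x _ /=; rewrite subr0.
exact: (@fine_cvg _ _ _ _ _ 0 h).
Qed.

End bounded_integrals.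
Arguments bounded_integrable {d T R P f} C.

(** * Pointwise and [L1] ergodic theorem for bounded functions *)

Section birkhoff.
Context d (S : measurableType d) (R : realType) (mu : probability S R).
Variables (tau : S -> S) (mtau : measurable_fun setT tau).
Hypothesis tau_preserving : forall A, measurable A -> mu (tau @^-1` A) = mu A.
Hypothesis tau_ergodic : forall A, measurable A -> tau @^-1` A = A ->
  mu A = 0%E \/ mu A = 1%E.

Definition birkhoff_sum (f : S -> R) n x := \sum_(i < n) f (iter i tau x).

Lemma birkhoff_sumS (f : S -> R) n x :
  birkhoff_sum f n.+1 x = f x + birkhoff_sum f n (tau x).
Proof.
rewrite /birkhoff_sum big_ord_recl; congr (_ + _).
by apply: eq_bigr => i _; rewrite /= -iterSr.
Qed.

Lemma measurable_iter n : measurable_fun setT (iter n tau).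
Proof.
elim: n => [|n IH]; first exact: measurable_id.
exact: (measurableT_comp mtau IH).
Qed.

Lemma measurable_birkhoff_sum (f : S -> R) n :
  measurable_fun setT f -> measurable_fun setT (birkhoff_sum f n).
Proof.
move=> mf; apply: measurable_sum => i.
exact: measurableT_comp mf (measurable_iter _).
Qed.

Lemma Rintegral_preserving (f : S -> R) (C : R) : measurable_fun setT f ->
  (forall x, `|f x| <= C) -> \int[mu]_x f (tau x) = \int[mu]_x f x.
Proof.
move=> mf fC; rewrite /Rintegral; congr fine.
have <- := @integral_pushforward _ _ S S R tau mtau mu setT (EFin \o f)
  ((measurable_EFinP _ _).2 mf)
  (bounded_integrable C (measurableT_comp mf mtau) (fun x => fC (tau x))) measurableT.
by apply: eq_measure_integral => A mA _; exact: tau_preserving.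
Qed.

(** This is the maximum of the sums of lengths [0, ..., n], the empty sum giving [0]. The recursive
    form turns measurability, boundedness and monotonicity in [n] into one-step inductions. *)
Fixpoint max_birkhoff (f : S -> R) n x : R :=
  if n is n'.+1 then Num.max 0 (f x + max_birkhoff f n' (tau x)) else 0.

Lemma max_birkhoff_ge0 (f : S -> R) n x : 0 <= max_birkhoff f n x.
Proof. by case: n => [|n] //=; rewrite le_max lexx. Qed.

Lemma birkhoff_le_max (f : S -> R) n x : birkhoff_sum f n x <= max_birkhoff f n x.
Proof.
elim: n x => [|n IH] x; first by rewrite /birkhoff_sum big_ord0.
by rewrite birkhoff_sumS /= le_max lerD2l IH orbT.
Qed.

Lemma max_birkhoff_homo (f : S -> R) n x : max_birkhoff f n x <= max_birkhoff f n.+1 x.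
Proof.
elim: n x => [|n IH] x; first exact: max_birkhoff_ge0.
by rewrite /= ge_max le_max lexx /= le_max lerD2l IH orbT.
Qed.

Lemma measurable_max_birkhoff (f : S -> R) n :
  measurable_fun setT f -> measurable_fun setT (max_birkhoff f n).
Proof.
move=> mf; elim: n => [|n IH] /=; first exact: measurable_cst.
apply: measurable_maxr; first exact: measurable_cst.
by apply: measurable_funD => //; exact: measurableT_comp IH mtau.
Qed.

Lemma max_birkhoff_bounded (f : S -> R) (C : R) n x :
  (forall x, `|f x| <= C) -> `|max_birkhoff f n x| <= C *+ n.
Proof.
move=> fC; have C0 : 0 <= C := le_trans (normr_ge0 _) (fC x).
rewrite ger0_norm ?max_birkhoff_ge0//; elim: n x => [|n IH] x //=.
rewrite ge_max mulrn_wge0//= mulrS lerD// (le_trans (ler_norm _))//.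
Qed.

(** On the set where [M = max_birkhoff f n] is positive, [M - M \o tau <= f];
    the left side integrates to [0]. *)
Lemma maximal_ergodic (f : S -> R) (C : R) n : measurable_fun setT f ->
  (forall x, `|f x| <= C) ->
  0 <= \int[mu]_x (f x * \1_[set x | 0 < max_birkhoff f n x] x).
Proof.
move=> mf fC; case: n => [|n].
  rewrite (_ : (fun x => _) = cst 0) ?Rintegral_cstT//; apply/funext => x.
  by rewrite indicE memNset ?mulr0//= ltxx.
set M := max_birkhoff f n.+1.
have mM : measurable_fun setT M by exact: measurable_max_birkhoff.
have MC x : `|M x| <= C *+ n.+1 by exact: max_birkhoff_bounded.
have mpos : measurable [set x | 0 < M x].
  by rewrite -[X in measurable X]setTI; exact: measurable_fun_ltr.
have iM : mu.-integrable setT (EFin \o M) by exact: bounded_integrable _ _ MC.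
have iMt : mu.-integrable setT (EFin \o (M \o tau)).
  exact: (bounded_integrable _ (measurableT_comp mM mtau) (fun x => MC (tau x))).
apply: (@le_trans _ _ (\int[mu]_x (M x - M (tau x)))).
  by rewrite RintegralB// (Rintegral_preserving mM MC) subrr.
apply: le_Rintegral => //.
- apply: (bounded_integrable (C *+ n.+1 + C *+ n.+1)).
    by apply: measurable_funB => //; exact: measurableT_comp.
  by move=> x; rewrite (le_trans (ler_normB _ _))// lerD.
- apply: (bounded_integrable C).
    by apply: measurable_funM => //; exact: measurable_indic.
  move=> x; rewrite normrM indicE; case: (_ \in _); rewrite ?normr1 ?mulr1//.
  by rewrite normr0 mulr0 (le_trans _ (fC x)).
move=> x _; rewrite indicE; have [Mx|Mx] := ltP 0 (M x).
  rewrite mem_set// mulr1 lerBlDr [leLHS]/M /=; move: Mx; rewrite [in X in X -> _]/M /=.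
  rewrite lt_max ltxx /= => Mx; rewrite ge_max (le_trans (ltW Mx)) /=.
    by rewrite lerD2l; exact: max_birkhoff_homo.
  by rewrite lerD2l; exact: max_birkhoff_homo.
rewrite memNset/= ?ltNge ?Mx// mulr0 subr_le0.
exact: le_trans Mx (max_birkhoff_ge0 _ _ _).
Qed.

(** The set where the sums are unbounded above is exactly invariant; if it had full
    measure, the maximal ergodic lemma would give [0 <= \int f] in the limit. *)
Lemma birkhoff_bounded_above (f : S -> R) (C : R) : measurable_fun setT f ->
  (forall x, `|f x| <= C) -> \int[mu]_x f x < 0 ->
  {ae mu, forall x, exists K, forall n, birkhoff_sum f n x <= K}.
Proof.
move=> mf fC f0.
pose A := \bigcap_(K in @setT nat) \bigcup_n [set x | K%:R < max_birkhoff f n x].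
have mK K n : measurable [set x | K%:R < max_birkhoff f n x :> R].
  rewrite -[X in measurable X]setTI; apply: measurable_fun_ltr => //.
  exact: measurable_max_birkhoff.
have mA : measurable A.
  by apply: bigcap_measurable => // K _; exact: bigcup_measurable.
(* Real thresholds can be moved by [f x], as passing between [x] and [tau x] requires. *)
have AE x : A x <-> forall K : R, exists n, K < max_birkhoff f n x.
  split=> [Ax K|Ax K _].
    have [k Kk] : exists k : nat, K < k%:R.
      by exists (Num.trunc K).+1; exact: truncnS_gt.
    by have [n _ /= kn] := Ax k I; exists n; exact: lt_trans kn.
  by have [n Kn] := Ax K%:R; exists n.
have A_inv : tau @^-1` A = A.
  apply/seteqP; split => x; rewrite /preimage /mkset !AE => Ax K.
    have [n Kn] := Ax (K - f x); exists n.+1 => /=.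
    by rewrite lt_max -ltrBlDl Kn orbT.
  (* A nonnegative threshold forces [n] to be positive and the maximum with [0] at [x] to be its
     second argument; cancelling [f x] then leaves the bound at [tau x]. *)
  have [n Kn] := Ax (Num.max 0 (K + f x)); exists n.-1.
  move: Kn; rewrite gt_max => /andP[]; case: n => [|n] /=; first by rewrite ltxx.
  by rewrite lt_max ltxx /= => n0; rewrite max_r ?(ltW n0)// addrC ltrD2l.
have [A0|A1] := tau_ergodic mA A_inv.
  exists A; split => // x /= h; apply/AE => K.
  apply: contrapT => /forallNP hK; apply: h; exists K => n.
  by apply: le_trans (birkhoff_le_max _ _ _) _; rewrite leNgt; exact/negP.
exfalso; move: f0; apply/negP; rewrite -leNgt.
pose g n x := f x * \1_[set x | 0 < max_birkhoff f n x] x.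
have mg n : measurable_fun setT (g n).
  apply: measurable_funM => //; apply: measurable_indic; exact: (mK 0%N n).
have gC n x : `|g n x| <= C.
  rewrite normrM indicE; case: (_ \in _); rewrite ?normr1 ?mulr1//.
  by rewrite normr0 mulr0 (le_trans _ (fC x)).
(* On [A] the maxima exceed [0] from some [n] on, by monotonicity, so there [g n] equals [f]
   eventually; [A] has full measure in this branch. *)
have h : \int[mu]_x `|g n x - f x| @[n --> \oo] --> 0.
  apply: (@bounded_Rintegral_cvg0 _ _ _ _ _ (C + C)).
  - by move=> n; exact: measurable_funB.
  - by move=> n x; rewrite (le_trans (ler_normB _ _))// lerD.
  exists (~` A); split; first exact: measurableC.
    by have := probability_setC mu mA; rewrite A1 subee.
  move=> x /= h Ax; apply: h.
  have /AE /(_ 0) [n n0] := Ax.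
  apply: cvg_near_cst; near=> k.
  suff -> : g k x = f x by rewrite subrr.
  rewrite /g indicE mem_set ?mulr1//=.
  have nk : (n <= k)%N by near: k; exact: nbhs_infty_ge.
  apply: lt_le_trans n0 _.
  have := @homo_leq _ (fun n => max_birkhoff f n x) (fun a b => a <= b) (@lexx _ _)
    (fun b a c => @le_trans _ _ b a c) (fun n => max_birkhoff_homo f n x).
  by apply.
suff H n : - (\int[mu]_x `|g n x - f x|) <= \int[mu]_x f x.
  rewrite -oppr0; apply: (ler_cvg_to (cvgN h) (cvg_cst (\int[mu]_x f x))).
  exact: nearW.
have ig : mu.-integrable setT (EFin \o g n) by exact: bounded_integrable _ _ (gC n).
have jf : mu.-integrable setT (EFin \o f) by exact: bounded_integrable _ _ fC.
have igf : mu.-integrable setT (EFin \o (fun x => g n x - f x)).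
  apply: (bounded_integrable (C + C)); first exact: measurable_funB.
  by move=> x; rewrite (le_trans (ler_normB _ _))// lerD.
rewrite lerNl; apply: le_trans _ (le_normr_Rintegral measurableT igf).
rewrite RintegralB//; have := @maximal_ergodic f C n mf fC.
rewrite -/(g n) => g0; apply: le_trans _ (ler_norm _).
by rewrite lerDr.
Unshelve. all: by end_near. Qed.

(** The functions [f - (m + 1/(k+1))] and [(m - 1/(k+1)) - f] have negative integral, so almost
    surely their sums are bounded above for all [k] at once. Divided by [n], these bounds vanish and
    squeeze the averages to within [1/(k+1)] of [m]. *)
Lemma birkhoff_ae (f : S -> R) (C : R) : measurable_fun setT f -> (forall x, `|f x| <= C) ->
  {ae mu, forall x, n%:R^-1 * birkhoff_sum f n x @[n --> \oo] --> \int[mu]_x f x}.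
Proof.
move=> mf fC; set m := \int[mu]_x f x.
have jf : mu.-integrable setT (EFin \o f) by exact: bounded_integrable _ _ fC.
have up k : {ae mu, forall x, exists K, forall n,
    birkhoff_sum (fun x => f x - (m + k.+1%:R^-1)) n x <= K}.
  apply: (@birkhoff_bounded_above _ (C + `|m + k.+1%:R^-1|)).
  - exact: measurable_funB.
  - by move=> x; rewrite (le_trans (ler_normB _ _))// lerD.
  rewrite RintegralB//; last exact: finite_measure_integrable_cst.
  by rewrite Rintegral_cstT -/m opprD addrA subrr sub0r oppr_lt0 invr_gt0.
have dn k : {ae mu, forall x, exists K, forall n,
    birkhoff_sum (fun x => (m - k.+1%:R^-1) - f x) n x <= K}.
  apply: (@birkhoff_bounded_above _ (`|m - k.+1%:R^-1| + C)).
  - exact: measurable_funB.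
  - by move=> x; rewrite (le_trans (ler_normB _ _))// lerD.
  rewrite RintegralB//; last exact: finite_measure_integrable_cst.
  by rewrite Rintegral_cstT -/m addrAC subrr sub0r oppr_lt0 invr_gt0.
have /ae_foralln := up => {}up; have /ae_foralln := dn => {}dn.
apply: filterS2 up dn => x up dn.
have aux (e a b c s : R) : a <= e / 2 -> b <= e / 2 -> c <= e / 2 ->
    s <= m + a + b -> m - a - c <= s -> `|m - s| <= e.
  by move=> *; rewrite ler_norml; apply/andP; split; lra.
apply/cvgrPdist_le => e e0.
have [k ke] : exists k : nat, k.+1%:R^-1 <= e / 2.
  exists (Num.trunc (e / 2)^-1); rewrite -[leRHS]invrK lef_pV2 ?posrE ?invr_gt0 ?divr_gt0//.
  by apply: ltW; rewrite truncnS_gt.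
have [K1 HK1] := up k; have [K2 HK2] := dn k.
have {}HK1 n : birkhoff_sum f n x <= (m + k.+1%:R^-1) * n%:R + K1.
  have := HK1 n; rewrite /birkhoff_sum sumrB sumr_const card_ord lerBlDl.
  by rewrite mulr_natr.
have {}HK2 n : (m - k.+1%:R^-1) * n%:R - K2 <= birkhoff_sum f n x.
  have := HK2 n; rewrite /birkhoff_sum sumrB sumr_const card_ord -[_ *+ n]mulr_natr.
  by rewrite !lerBlDr [K2 + _]addrC.
near=> n.
have n0 : 0 < n%:R :> R by rewrite ltr0n; near: n; exact: nbhs_infty_gt.
have nK1 : K1 / n%:R <= e / 2.
  rewrite ler_pdivrMr// -ler_pdivrMl ?divr_gt0//.
  near: n; exact: nbhs_infty_ger.
have nK2 : K2 / n%:R <= e / 2.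
  rewrite ler_pdivrMr// -ler_pdivrMl ?divr_gt0//.
  near: n; exact: nbhs_infty_ger.
have h1 : n%:R^-1 * birkhoff_sum f n x <= (m + k.+1%:R^-1) + K1 / n%:R.
  rewrite ler_pdivrMl//; apply: le_trans (HK1 n) _.
  by rewrite mulrDr [n%:R * (K1 / _)]mulrC divfK ?gt_eqF// lerD2r mulrC.
have h2 : (m - k.+1%:R^-1) - K2 / n%:R <= n%:R^-1 * birkhoff_sum f n x.
  rewrite ler_pdivlMl//; apply: le_trans _ (HK2 n).
  by rewrite mulrBr [n%:R * (K2 / _)]mulrC divfK ?gt_eqF// lerD2r mulrC.
exact: aux ke nK1 nK2 h1 h2.
Unshelve. all: by end_near. Qed.

Lemma normr_birkhoff_average (f : S -> R) (C : R) n x : (forall x, `|f x| <= C) ->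
  `|n%:R^-1 * birkhoff_sum f n x| <= C.
Proof.
move=> fC; rewrite normrM.
have [->|n0] := posnP n; first by rewrite invr0 normr0 mul0r (le_trans _ (fC x)).
rewrite normfV normr_nat ler_pdivrMl ?ltr0n//.
rewrite (le_trans (ler_norm_sum _ _ _))//.
rewrite (le_trans (ler_sum _ (fun i _ => fC _)))// sumr_const card_ord.
by rewrite mulr_natl.
Qed.

Lemma birkhoff_L1 (f : S -> R) (C : R) : measurable_fun setT f -> (forall x, `|f x| <= C) ->
  \int[mu]_x `|n%:R^-1 * birkhoff_sum f n x - \int[mu]_x f x| @[n --> \oo] --> 0.
Proof.
move=> mf fC.
apply: (@bounded_Rintegral_cvg0 _ _ _ _ _ (C + `|\int[mu]_x f x|)).
- move=> n; apply: measurable_funB => //; apply: measurable_funM => //.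
  exact: measurable_birkhoff_sum.
- move=> n x; rewrite (le_trans (ler_normB _ _))// lerD2r.
  exact: normr_birkhoff_average.
apply: filterS (birkhoff_ae mf fC) => x /= h.
rewrite -(subrr (\int[mu]_x f x)).
by apply: cvgB h _; exact: cvg_cst.
Qed.

End birkhoff.

(** * Two-sided path space and ergodic averages of stationary processes *)

Section path_space.
Context dE (E : measurableType dE).

Definition path_cylinders : set (set (int -> E)) :=
  [set C | exists t, exists2 A : set E, measurable A & C = [set w : int -> E | A (w t)]].

(** Its measurable sets are by conversion those of [path_measurable], so stationarity and ergodicity
    of a process serve directly as properties of the shift under the law of the path. *)
Definition path_space := g_sigma_algebraType path_cylinders.

Lemma measurable_coord (t : int) : measurable_fun setT (fun w : path_space => w t).
Proof.
move=> _ A mA; rewrite setTI; apply: sub_sigma_algebra.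
by exists t, A.
Qed.

Lemma measurable_path d (T : measurableType d) (f : T -> path_space) :
  (forall t, measurable_fun setT (fun x => f x t)) -> measurable_fun setT f.
Proof.
move=> mf; apply: (@measurability _ _ T path_space setT f path_cylinders erefl).
move=> _ [_ [t [A mA ->]] <-]; rewrite setTI.
by have := mf t measurableT _ mA; rewrite setTI.
Qed.

Lemma measurable_shift_path :
  measurable_fun setT (@shift_path _ E : path_space -> path_space).
Proof. by apply: measurable_path => t; exact: measurable_coord. Qed.

Lemma iter_shift_path n (w : int -> E) :
  iter n (@shift_path _ E) w = fun t => w (t + n%:Z).
Proof.
elim: n => [|n IH] /=; first by apply/funext => t; rewrite addr0.
by rewrite IH /shift_path; apply/funext => t; rewrite -addrA -add1n PoszD.
Qed.

End path_space.

Section stationary_process.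
Context d (T : measurableType d) (R : realType) (P : probability T R).
Context dE (E : measurableType dE) (Z : int -> T -> E).
Hypothesis mZ : forall t, measurable_fun setT (Z t).

Lemma stationary_shift (A : set (int -> E)) n :
  strictly_stationary P Z -> path_measurable A ->
  P [set x | A (fun t => Z (t + n%:Z) x)] = P [set x | A (sample_path Z x)].
Proof.
move=> stZ; elim: n A => [|n IH] A mA.
  by congr (P _); apply/funext => x; congr A; apply/funext => t; rewrite addr0.
rewrite -[RHS]stZ// -[RHS](IH (@shift_path _ E @^-1` A)).
  congr (P _); apply/funext => x; congr A; apply/funext => t.
  by rewrite /shift_path -addrA -add1n PoszD.
have := @measurable_shift_path _ E measurableT A mA.
by rewrite setTI.
Qed.

(** This is the [L1] ergodic theorem for the law of the path under the shift, pulled back to [T].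
    Since [f] sees the whole path, a summand may involve several times, as lagged variables do. *)
Lemma ergodic_average (f : path_space E -> R) (C : R) :
  strictly_stationary P Z -> ergodic P Z ->
  measurable_fun setT f -> (forall w, `|f w| <= C) ->
  \int[P]_x `|N%:R^-1 * (\sum_(i < N) f (fun t => Z (t + i%:Z) x)) -
              \int[P]_x f (sample_path Z x)| @[N --> \oo] --> 0.
Proof.
move=> stZ erZ mf fC.
have mS : measurable_fun setT (sample_path Z : T -> path_space E).
  exact: measurable_path.
pose X : {mfun T >-> path_space E} := HB.pack (sample_path Z : T -> path_space E)
  (isMeasurableFun.Build _ _ _ _ _ mS).
pose mu : probability (path_space E) R := distribution P X.
have intE (g : path_space E -> R) K : measurable_fun setT g ->
    (forall w, `|g w| <= K) -> \int[mu]_w g w = \int[P]_x g (sample_path Z x).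
  move=> mg gK; rewrite /Rintegral; congr fine.
  apply: (@integral_pushforward _ _ _ _ _ _ mS P setT (EFin \o g)) => //.
    exact/measurable_EFinP.
  rewrite preimage_setT; apply: (bounded_integrable K) => //.
  exact: measurableT_comp mg mS.
have := @birkhoff_L1 _ _ _ mu _ (@measurable_shift_path _ E) stZ erZ f C mf fC.
rewrite (intE f C)//.
apply: cvg_trans; apply: near_eq_cvg; apply: nearW => N.
rewrite (intE _ (C + `|\int[P]_x f (sample_path Z x)|)); last 2 first.
- apply: measurableT_comp => //; apply: measurable_funB => //.
  apply: measurable_funM => //; apply: measurable_birkhoff_sum => //.
  exact: measurable_shift_path.
- move=> w; rewrite normr_id (le_trans (ler_normB _ _))// lerD2r.
  exact: normr_birkhoff_average.
congr Rintegral; apply/funext => x; congr (`|_ * _ - _|).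
by apply: eq_bigr => i _; rewrite iter_shift_path.
Qed.

End stationary_process.

(** * Generating functions: bounds, Lipschitz dependence and measurability in the intensity *)

Section generating_function.
Context (R : realType) (F : R -> probability nat R).

Definition epgf (l u : R) : \bar R := (\sum_(0 <= k <oo) (u ^+ k)%:E * F l [set k])%E.

Lemma epgf_ge0 l u : 0 <= u -> (0 <= epgf l u)%E.
Proof.
by move=> u0; apply: nneseries_ge0 => k _ _; rewrite mule_ge0// lee_fin exprn_ge0.
Qed.

Lemma sum_atoms l : (\sum_(0 <= k <oo) F l [set k] = 1)%E.
Proof.
rewrite -(probability_setT (F l)).
have -> : [set: nat] = \bigcup_k [set k] by apply/seteqP; split=> // k _; exists k.
rewrite measure_bigcup//; first by apply: eq_eseriesl => k; rewrite in_setT.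
by apply/trivIsetP => i j _ _ ij; apply/seteqP; split=> // k [/= -> /eqP]; rewrite (negPf ij).
Qed.

Lemma epgf_le1 l u : 0 <= u <= 1 -> (epgf l u <= 1)%E.
Proof.
move=> /andP[u0 u1]; rewrite -(sum_atoms l); apply: lee_nneseries => k _.
  by rewrite mule_ge0// lee_fin exprn_ge0.
by rewrite gee_pMl// ?lee_fin ?exprn_ile1// fin_num_measure.
Qed.

Lemma epgfK l u : 0 <= u <= 1 -> ((pgf F l u)%:E = epgf l u)%E.
Proof.
move=> u01; rewrite fineK// ge0_fin_numE; last by apply: epgf_ge0; case/andP: u01.
by rewrite (le_lt_trans (epgf_le1 l u01))// ltry.
Qed.

Lemma pgf_ge0_le1 l u : 0 <= u <= 1 -> 0 <= pgf F l u <= 1.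
Proof.
move=> u01; rewrite -!lee_fin epgfK// epgf_le1// andbT; apply: epgf_ge0.
by case/andP: u01.
Qed.

Lemma pgf_lipschitz (M : R) u :
  (forall l : R, 0 < l -> derivable (fun l' => pgf F l' u) l 1) ->
  (forall l : R, 0 < l -> `|derive1 (fun l' => pgf F l' u) l| < M) ->
  forall l1 l2, 0 < l1 -> 0 < l2 ->
    `|pgf F l1 u - pgf F l2 u| <= M * `|l1 - l2|.
Proof.
move=> df dM.
suff H l1 l2 : 0 < l1 -> l1 <= l2 -> `|pgf F l1 u - pgf F l2 u| <= M * `|l1 - l2|.
  move=> l1 l2 l10 l20; have [l12|/ltW l21] := leP l1 l2; first exact: H.
  by rewrite distrC [`|l1 - l2|]distrC; exact: H.
move=> l10 l12; have pos x : l1 <= x -> 0 < x by exact: lt_le_trans.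
have [x||c /[!in_itv]/= /andP[/pos c0 _] E] :=
    @MVT_segment R (fun l => pgf F l u) (derive1 (fun l' => pgf F l' u)) l1 l2 l12.
- rewrite in_itv/= => /andP[/ltW/pos x0 _].
  by rewrite derive1E; apply: derivableP; exact: df.
- apply: derivable_within_continuous => x; rewrite in_itv/= => /andP[/pos x0 _].
  exact: df.
rewrite distrC [`|l1 - l2|]distrC E normrM ler_wpM2r//.
exact: ltW (dM _ c0).
Qed.

End generating_function.

Section measurable_family.
Context (R : realType) (F : R -> probability nat R) (F_order : stochastic_order F).
Context d (T : measurableType d) (L : T -> R).
Hypotheses (mL : measurable_fun setT L) (L_gt0 : forall x, 0 < L x).

(** Distribution functions are monotone in the parameter, hence measurable in it. *)
Lemma measurable_family_lt k :
  measurable_fun setT (fun x => F (L x) [set j | (j < k)%N]).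
Proof.
(* The order condition concerns positive parameters only. The value [1] at the others dominates
   every distribution function, so [G] is nonincreasing on the whole line. *)
pose G l := if 0 < l then fine (F l [set j | (j < k)%N]) else 1.
have Fle1 l : fine (F l [set j | (j < k)%N]) <= 1.
  by rewrite -lee_fin fineK ?fin_num_measure// probability_le1.
have G_noninc : nonincreasing_fun G.
  move=> a b ab; rewrite /G; case: ifPn => [b0|b0]; last first.
    by rewrite ifF//; apply: contraNF b0 => /lt_le_trans; exact.
  case: ifPn => [a0|//].
  (* For [k = 0] the set is empty; for a successor, [j < k.+1] is [j <= k], the form used in the
     order condition. *)
  case: k @G Fle1 => [|k] _ _.
    by rewrite (_ : [set j | _] = set0) ?measure0//; apply/seteqP; split.
  rewrite fine_le ?fin_num_measure//.
  have := F_order a0 ab k%:R.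
  rewrite (_ : [set j : nat | _] = [set j | (j < k.+1)%N])//.
  by apply/funext => j /=; rewrite ler_nat ltnS.
rewrite (_ : (fun x => _) = (fun x => (G (L x))%:E)).
  apply/measurable_EFinP; apply: measurableT_comp mL.
  exact: nonincreasing_measurable.
by apply/funext => x; rewrite /G L_gt0 fineK// fin_num_measure.
Qed.

Lemma measurable_family_atom k : measurable_fun setT (fun x => F (L x) [set k]).
Proof.
rewrite (_ : (fun x => _) = (fun x => F (L x) [set j | (j < k.+1)%N] -
    F (L x) [set j | (j < k)%N])%E).
  by apply: emeasurable_funB; exact: measurable_family_lt.
apply/funext => x.
rewrite (_ : [set j | (j < k.+1)%N] = [set k] `|` [set j | (j < k)%N]).
  rewrite measureU//.
    by rewrite addeK// fin_num_measure.
  by apply/seteqP; split => // j [/= ->]; rewrite ltnn.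
apply/seteqP; split => j /=.
  by rewrite ltnS leq_eqVlt => /orP[/eqP|]; [left|right].
by case=> [->//|]; exact: ltnW.
Qed.

(** The absolute value makes every term of the series nonnegative for any [f]; in the applications
    the argument lies in [[0, 1]] and the norm disappears. *)
Lemma measurable_epgf (f : T -> R) : measurable_fun setT f ->
  measurable_fun setT (fun x => epgf F (L x) `|f x|).
Proof.
move=> mf; apply: ge0_emeasurable_sum => k.
  by move=> x _ _; rewrite mule_ge0// lee_fin exprn_ge0.
move=> _; apply: emeasurable_funM; last exact: measurable_family_atom.
apply/measurable_EFinP; apply: measurable_funX; exact: measurableT_comp.
Qed.

Lemma measurable_pgf (f : T -> R) : measurable_fun setT f ->
  measurable_fun setT (fun x => pgf F (L x) `|f x|).
Proof.
by move=> mf; apply: measurableT_comp (measurable_epgf mf).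
Qed.

End measurable_family.

(** * Orthogonality of the residual to functions of the past *)

Section conditional_law.
Context d (T : measurableType d) (R : realType) (P : probability T R).

(** The sum is the ceiling of [y]: it counts the naturals below [y], and [y <= n] guarantees that
    none is missed. *)
Lemma layer_approximation n (y : R) : 0 <= y <= n%:R ->
  y <= \sum_(j < n) ((j%:R < y)%R%:R : R) <= y + 1.
Proof.
elim: n y => [|n IH] y.
  by rewrite big_ord0 => /andP[y0 y1]; rewrite y1 addr_ge0.
move=> /andP[y0 yn]; have [ny|yn'] := ltP n%:R y.
  rewrite (eq_bigr (fun=> 1)) => [|i _].
    rewrite sumr_const card_ord yn -natr1 lerD2r; exact: ltW.
  by rewrite (le_lt_trans _ ny)// ler_nat -ltnS.
rewrite big_ord_recr/= ltNge yn' addr0; apply: IH.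
by rewrite y0.
Qed.

Lemma normr_indic (A : set T) x : `|\1_A x : R| <= 1.
Proof. by rewrite indicE; case: (_ \in _); rewrite ?normr1 ?normr0. Qed.

(** [phi] is a uniform limit of averages of indicators of the sets [c < phi]. *)
Lemma Rintegral_orthogonal (G : set (set T)) (xi phi : T -> R) :
  (forall B, G B -> measurable B) -> G setT ->
  measurable_fun setT xi -> (forall x, `|xi x| <= 1) ->
  (forall B, G B -> \int[P]_x (xi x * \1_B x) = 0) ->
  (forall x, `|phi x| <= 1) -> (forall c, G [set x | c < phi x]) ->
  \int[P]_x (xi x * phi x) = 0.
Proof.
move=> GM GT mxi xi1 xiG phi1 Gphi.
have mphi : measurable_fun setT phi.
  apply: (measurability (@RGenOInfty.G R)); first exact: RGenOInfty.measurableE.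
  move=> _ [_] [c] -> <-; rewrite setTI; apply: GM.
  rewrite (_ : _ @^-1` _ = [set x | c < phi x])//.
  by apply/seteqP; split => x /=; rewrite in_itv/= andbT.
pose psi x := (phi x + 1) / 2.
have psi01 x : 0 <= psi x <= 1.
  by have := phi1 x; rewrite ler_norml /psi => /andP[? ?]; apply/andP; split; lra.
have mpsi : measurable_fun setT psi.
  by apply: measurable_funM => //; exact: measurable_funD.
pose layer (n j : nat) := [set x | j%:R < n%:R * psi x].
have Glayer n j : (0 < n)%N -> G (layer n j).
  move=> n0; have := Gphi (j%:R / n%:R * 2 - 1).
  rewrite (_ : [set x | _] = layer n j)//; apply/seteqP; split => x; rewrite /layer /= /psi.
    rewrite ltrBlDr -ltr_pdivlMr// ltr_pdivrMr ?ltr0n//.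
    by rewrite [n%:R * _]mulrC.
  rewrite ltrBlDr -ltr_pdivlMr// ltr_pdivrMr ?ltr0n//.
  by rewrite [n%:R * _]mulrC.
pose app n x := n%:R^-1 * \sum_(j < n) \1_(layer n j) x : R.
have mapp n : (0 < n)%N -> measurable_fun setT (app n).
  move=> n0; apply: measurable_funM => //; apply: measurable_sum => j.
  by apply: measurable_indic; apply: GM; exact: Glayer.
have appP n x : (0 < n)%N -> `|psi x - app n x| <= n%:R^-1.
  move=> n0; have n0R : 0 < n%:R :> R by rewrite ltr0n.
  have /layer_approximation : 0 <= n%:R * psi x <= n%:R.
    have /andP[p0 p1] := psi01 x; rewrite mulr_ge0//= -[leRHS]mulr1.
    by rewrite ler_wpM2l.
  rewrite (eq_bigr (fun j : 'I_n => \1_(layer n j) x)) => [/andP[h1 h2]|j _].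
    rewrite distrC ler_norml /app; apply/andP; split.
      rewrite lerBrDr (le_trans (_ : _ <= psi x))//.
        by rewrite addrC lerBlDr lerDl invr_ge0.
      by rewrite ler_pdivlMl.
    by rewrite lerBlDr ler_pdivrMl// mulrDr divff ?gt_eqF// addrC.
  rewrite indicE /layer; congr (_%:R); congr nat_of_bool.
  by apply/idP/idP => [h|]; [rewrite inE|rewrite inE].
have xi_bdd (f : T -> R) : measurable_fun setT f -> (forall x, `|f x| <= 1) ->
    P.-integrable setT (EFin \o (fun x => xi x * f x)).
  move=> mf f1; apply: (bounded_integrable 1); first exact: measurable_funM.
  by move=> x; rewrite normrM mulr_ile1.
have xi_app n : (0 < n)%N -> \int[P]_x (xi x * app n x) = 0.
  move=> n0; rewrite (_ : (fun x => _) =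
      (fun x => \sum_(j < n) n%:R^-1 * (xi x * \1_(layer n j) x))).
    have ilayer (j : 'I_n) : P.-integrable setT
        (EFin \o (fun x => n%:R^-1 * (xi x * \1_(layer n j) x))).
      apply: (bounded_integrable n%:R^-1).
        apply: measurable_funM => //; apply: measurable_funM => //.
        by apply: measurable_indic; apply: GM; exact: Glayer.
      move=> x; rewrite normrM normfV normr_nat ler_piMr ?invr_ge0//.
      by rewrite normrM mulr_ile1// normr_indic.
    rewrite /Rintegral; under eq_integral do rewrite -sumEFin.
    rewrite integral_sum// big1// => j _; rewrite -[LHS]fineK; last first.
      by apply: integrable_fin_num => //; exact: ilayer.
    congr EFin; rewrite -[LHS]/(\int[P]_x (n%:R^-1 * (xi x * \1_(layer n j) x))).
    rewrite RintegralZl// ?xiG ?mulr0//; first exact: Glayer.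
    apply: xi_bdd => [|x]; last exact: normr_indic.
    by apply: measurable_indic; apply: GM; exact: Glayer.
  by apply/funext => x; rewrite /app mulrCA !mulr_sumr.
have psi1 x : `|psi x| <= 1.
  by have /andP[? ?] := psi01 x; rewrite ger0_norm.
have xi_psi : \int[P]_x (xi x * psi x) = 0.
  apply/eqP; rewrite -normr_le0; apply/ler_addgt0Pr => e e0; rewrite add0r.
  pose n := (Num.trunc e^-1).+1.
  have ne : n%:R^-1 <= e.
    by rewrite -[leRHS]invrK lef_pV2 ?posrE ?invr_gt0 ?ltr0n//; exact/ltW/truncnS_gt.
  have app1 x : `|app n x| <= 1.
    rewrite /app normrM normfV normr_nat ler_pdivrMl ?ltr0n// mulr1.
    rewrite (le_trans (ler_norm_sum _ _ _))//.
    rewrite (le_trans (ler_sum _ (fun i _ => normr_indic _ _)))//.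
    by rewrite sumr_const card_ord.
  rewrite -(subr0 (\int[P]_x _)) -(xi_app n)// -RintegralB//; last 2 first.
    exact: xi_bdd.
    by apply: xi_bdd => //; exact: mapp.
  have mdiff : measurable_fun setT (fun x => xi x * psi x - xi x * app n x).
    by apply: measurable_funB; apply: measurable_funM => //; exact: mapp.
  have bdiff x : `|xi x * psi x - xi x * app n x| <= e.
    rewrite -mulrBr normrM (le_trans _ ne)// -[leRHS]mul1r.
    by rewrite ler_pM// appP.
  have idiff := bounded_integrable (P := P) _ mdiff bdiff.
  apply: le_trans (le_normr_Rintegral measurableT idiff) _.
  rewrite -[leRHS](Rintegral_cstT P e); apply: le_Rintegral => //.
    apply: (bounded_integrable e) => [|x]; first exact: measurableT_comp.
    by rewrite normr_id.
  exact: finite_measure_integrable_cst.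
(* Undoing the rescaling of [phi] to [[0, 1]] leaves a constant part, which is orthogonal to [xi]
   because [setT] belongs to [G]. *)
rewrite (_ : (fun x => _) = (fun x => 2 * (xi x * psi x) - xi x * \1_setT x)).
  rewrite RintegralB//; last 2 first.
  - apply: (bounded_integrable 2).
      by apply: measurable_funM => //; exact: measurable_funM.
    by move=> x; rewrite normrM ger0_norm// ler_piMr// normrM mulr_ile1.
  - by apply: xi_bdd => [|x]; [exact: measurable_indic|exact: normr_indic].
  rewrite RintegralZl// ?xi_psi ?mulr0 ?xiG ?subr0//.
  exact: xi_bdd.
by apply/funext => x; rewrite indicT /psi mulr1; field.
Qed.

(** Over [B], both parts integrate to the series of [u ^ k * P (Y = k, B)]: the first by splitting
    according to the value of [Y], the second by expanding the generating function and using the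
    conditional law of each atom. *)
Lemma conditional_pgf (F : R -> probability nat R) (Y : T -> nat) (G : set (set T))
    (lam : T -> R) (u : R) (B : set T) :
  stochastic_order F -> measurable_fun setT Y -> measurable_fun setT lam ->
  (forall x, 0 < lam x) -> conditional_law P Y G F lam -> 0 <= u <= 1 ->
  measurable B -> G B ->
  \int[P]_x ((u ^+ Y x - pgf F (lam x) u) * \1_B x) = 0.
Proof.
move=> F_order mY mlam lam0 [_ Ylaw] u01 mB GB.
have u0 : 0 <= u by case/andP: u01.
have mpgf : measurable_fun setT (fun x => pgf F (lam x) u).
  rewrite (_ : (fun x => _) = (fun x => pgf F (lam x) `|cst u x|)).
    exact: measurable_pgf.
  by apply/funext => x /=; rewrite ger0_norm.
have mpow : measurable_fun setT (fun x => u ^+ Y x).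
  by rewrite (_ : (fun x => _) = (fun k => u ^+ k) \o Y)//; exact: measurableT_comp mY.
have m1B : measurable_fun setT (\1_B : T -> R) by exact: measurable_indic.
have bpow x : `|u ^+ Y x| <= 1.
  by case/andP: u01 => _ u1; rewrite ger0_norm ?exprn_ge0// exprn_ile1.
have bpgf x : `|pgf F (lam x) u| <= 1.
  by have /andP[? ?] := pgf_ge0_le1 F (lam x) u01; rewrite ger0_norm.
under eq_Rintegral do rewrite mulrBl.
rewrite RintegralB//; last 2 first.
- apply: (bounded_integrable 1) => [|x]; first exact: measurable_funM.
  by rewrite normrM mulr_ile1// normr_indic.
- apply: (bounded_integrable 1) => [|x]; first exact: measurable_funM.
  by rewrite normrM mulr_ile1// normr_indic.
apply/eqP; rewrite subr_eq0; apply/eqP; congr fine.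
have toB (f : T -> R) : (\int[P]_x (f x * \1_B x)%:E = \int[P]_(x in B) (f x)%:E)%E.
  rewrite [RHS]integral_mkcond; apply: eq_integral => x _.
  by rewrite patchE indicE; case: ifPn => _; rewrite ?mulr1 ?mulr0.
rewrite !toB.
transitivity (\sum_(0 <= k <oo) (u ^+ k)%:E * P ([set x | Y x = k] `&` B))%E.
  transitivity (\int[P]_(x in B)
     \sum_(0 <= k <oo) ((u ^+ k)%:E * (\1_[set x | Y x = k] x)%:E))%E.
    apply: eq_integral => x _; rewrite (@nneseriesD1 _ _ (Y x))//; last first.
      by move=> k _; rewrite -EFinM lee_fin mulr_ge0// exprn_ge0.
    rewrite indicE mem_set// mule1 eseries0 ?adde0// => k _ /=.
    rewrite eq_sym => kY; rewrite indicE memNset ?mule0// => Yk.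
    by move: kY; rewrite Yk eqxx.
  have mYk k : measurable [set x | Y x = k].
    by have := mY measurableT [set k] I; rewrite setTI.
  rewrite integral_nneseries//; last 2 first.
  - move=> k; apply/measurable_EFinP; apply: measurable_funTS.
    by apply: measurable_funM => //; exact: measurable_indic.
  - by move=> k x _; rewrite -EFinM lee_fin mulr_ge0// exprn_ge0.
  apply: eq_eseriesr => k _.
  rewrite ge0_integralZl_EFin ?exprn_ge0//; last first.
    by apply/measurable_EFinP; apply: measurable_funTS; exact: measurable_indic.
  by rewrite integral_indic.
transitivity (\int[P]_(x in B) epgf F (lam x) u)%E; last first.
  by apply: eq_integral => x _; rewrite epgfK.
rewrite /epgf integral_nneseries//; last 2 first.
- move=> k; apply: measurable_funTS; apply: emeasurable_funM => //.
  exact: measurable_family_atom.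
- by move=> k x _; rewrite mule_ge0// lee_fin exprn_ge0.
apply: eq_eseriesr => k _.
rewrite ge0_integralZl_EFin ?exprn_ge0//; last first.
  by apply: measurable_funTS; exact: measurable_family_atom.
by rewrite -(Ylaw [set k] B GB).
Qed.

End conditional_law.

(** Nothing is asked of [g]: any preimage is a countable union of fibres of [k]. The codes of
    [pickle] enumerate the fibres, and injectivity of [pickle] makes each piece empty or a single
    fibre. *)
Lemma measurable_countable_comp d (T : measurableType d) d' (U : measurableType d')
    (I : countType) (k : T -> I) (g : I -> U) :
  (forall c, measurable [set x | k x = c]) -> measurable_fun setT (g \o k).
Proof.
move=> mk _ B mB; rewrite setTI.
rewrite (_ : _ @^-1` B = \bigcup_n [set x | pickle (k x) = n /\ B (g (k x))]).
  apply: bigcup_measurable => n _.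
  have [[x0 [<- Bx0]]|h] := pselect (exists x, pickle (k x) = n /\ B (g (k x))).
    rewrite (_ : [set x | _] = [set x | k x = k x0]) => [|]; first exact: mk.
    apply/seteqP; split => x /= => [[/(pcan_inj pickleK)//]|->//].
  rewrite (_ : [set x | _] = set0)//; apply/seteqP; split => // x hx.
  by apply: h; exists x.
by apply/seteqP; split => x /= => [Bx|[_ _ []]//]; exists (pickle (k x)).
Qed.

(** * Grid approximation and functions continuous on part of the space *)

Section grid.
Context (R : realType).

Definition grid_index n (N : nat) (z : 'rV[R]_n) : 'rV[int]_n :=
  \row_i Num.floor (z 0 i * N.+1%:R).

Definition grid_point n (N : nat) (c : 'rV[int]_n) : 'rV[R]_n :=
  \row_i ((c 0 i)%:~R / N.+1%:R).

(** Rounding takes countably many values, so any function of the rounded point is measurable.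
    Rounding down, rather than to the nearest point, keeps the nonnegative orthant stable. *)
Definition grid n N (z : 'rV[R]_n) := grid_point N (grid_index N z).

Lemma grid_le n N (z : 'rV[R]_n) i : 0 <= z 0 i - grid N z 0 i <= N.+1%:R^-1.
Proof.
rewrite !mxE; have N0 : 0 < N.+1%:R :> R by rewrite ltr0n.
have /andP[h1 h2] := floor_itv (z 0 i * N.+1%:R).
rewrite subr_ge0 ler_pdivrMr// h1 /= lerBlDr -[X in X + _]mul1r -mulrDl.
by rewrite ler_pdivlMr// (le_trans (ltW h2))// intrD addrC.
Qed.

Lemma cvg_grid n (z : 'rV[R]_n) : grid N z @[N --> \oo] --> z.
Proof.
apply/cvg_ballP => e e0; near=> N; split=> // i j; rewrite (ord1 i).
have /andP[h1 h2] := grid_le N z j.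
rewrite /ball/= ger0_norm// (le_lt_trans h2)//.
by near: N; exact: (near_infty_natSinv_lt (PosNum e0)).
Unshelve. all: by end_near. Qed.

Lemma grid_nonneg n N (z : 'rV[R]_n) : nonneg_rV z -> nonneg_rV (grid N z).
Proof.
move=> z0 i; rewrite !mxE divr_ge0// ler0z floor_ge0.
by rewrite mulr_ge0.
Qed.

Lemma measurable_grid_index d (T : measurableType d) n N (Z : T -> 'rV[R]_n) c :
  measurable_fun setT Z -> measurable [set x | grid_index N (Z x) = c].
Proof.
move=> mZ; rewrite (_ : [set x | _] = \bigcap_(i : 'I_n)
    (fun x => Z x 0 i * N.+1%:R) @^-1` [set` `[(c 0 i)%:~R, (c 0 i + 1)%:~R[]).
  apply: fin_bigcap_measurable => // i _.
  rewrite -[X in measurable X]setTI.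
  apply: measurable_funM => //.
  exact: (measurableT_comp (measurable_entry _ _) mZ).
apply/seteqP; split => x /= => [<- i _|h].
  by rewrite /= in_itv/= mxE; exact: floor_itv.
apply/rowP => i; rewrite mxE; apply/eqP; rewrite floor_eq.
by have := h i I; rewrite /= in_itv.
Qed.

Section continuous_on.
Context (p K : nat) (f : 'rV[R]_p -> 'rV[R]_K -> R) (D : set 'rV[R]_p).
Hypothesis f_cont : {within [set z : 'rV[R]_p * 'rV[R]_K | D z.1],
  continuous (fun z : 'rV[R]_p * 'rV[R]_K => f z.1 z.2)}.

(** The composite is the pointwise limit of its values at grid points. Each approximant factors
    through a countable type, and stability of [D] under rounding keeps the approximating points
    where continuity applies. *)
Lemma measurable_continuous_comp d (T : measurableType d)
    (A : T -> 'rV[R]_p) (B : T -> 'rV[R]_K) :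
  (forall N z, D z -> D (grid N z)) ->
  measurable_fun setT A -> measurable_fun setT B -> (forall x, D (A x)) ->
  measurable_fun setT (fun x => f (A x) (B x)).
Proof.
move=> Dgrid mA mB DA.
apply: (@measurable_fun_cvg _ _ _ _ (fun N x => f (grid N (A x)) (grid N (B x)))).
  move=> N; pose g (c : 'rV[int]_p * 'rV[int]_K) :=
    f (grid_point N c.1) (grid_point N c.2).
  apply: (@measurable_countable_comp _ _ _ _ _
    (fun x => (grid_index N (A x), grid_index N (B x))) g) => -[a b].
  rewrite (_ : [set x | _] = [set x | grid_index N (A x) = a] `&`
      [set x | grid_index N (B x) = b]).
    by apply: measurableI; exact: measurable_grid_index.
  by apply/seteqP; split => x /= => [[-> ->]|[-> ->]].
move=> x _; have /subspace_continuousP/(_ (A x, B x) (DA x)) hx := f_cont.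
apply: (@cvg_comp _ _ _ (fun N => (grid N (A x), grid N (B x)))
  (fun z => f z.1 z.2) _ _ _ _ hx) => U /= hU.
have gAB : (grid N (A x), grid N (B x)) @[N --> \oo] --> (A x, B x).
  exact: (@cvg_pair _ _ _ \oo (nbhs (A x)) (nbhs (B x)) _ _ _ _ _ (@cvg_grid _ _) (@cvg_grid _ _)).
have h : \forall N \near \oo,
  D (grid N (A x)) -> U (grid N (A x), grid N (B x)) := gAB _ hU.
change (\forall N \near \oo, U (grid N (A x), grid N (B x))).
by apply: filterS h => N; apply; exact: Dgrid.
Qed.

(** Around each [y] in [C], continuity at [(y, theta0)] gives a product neighbourhood where [f] is
    within [e / 2] of its value at the centre; both [(y', theta)] and [(y', theta0)] are compared
    with that centre. *)
Lemma compact_uniform_continuity (C : set 'rV[R]_p) (theta0 : 'rV[R]_K) (e : R) :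
  compact C -> C `<=` D -> 0 < e ->
  \forall theta \near theta0, forall y, C y -> `|f y theta - f y theta0| <= e.
Proof.
move=> /compact_near_coveringP cC CD e0.
have e20 : 0 < e / 2 by rewrite divr_gt0.
(* The guard [D y] is needed because the covering neighbourhoods may leave [D], where continuity
   says nothing. *)
pose Q theta y := D y -> `|f y theta - f y theta0| <= e.
suff : \forall theta \near theta0, C `<=` Q theta.
  by apply: filterS => theta h y Cy; exact: h (CD _ Cy).
apply: (cC _ (nbhs theta0) Q) => y Cy.
have /subspace_continuousP/(_ (y, theta0) (CD _ Cy)) := f_cont.
move=> /cvgrPdist_lt/(_ _ e20) [[U V] /= [Uy V0] UV].
exists (U, V) => // -[y' theta] /= [Uy' Vt] Dy'.
have h1 := UV (y', theta) (conj Uy' Vt) Dy'.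
have h2 := UV (y', theta0) (conj Uy' (nbhs_singleton V0)) Dy'.
rewrite /= in h1 h2.
rewrite [e]splitr -(subrKA (f y theta0)) (le_trans (ler_normD _ _))// lerD// ltW//.
by rewrite distrC.
Qed.

End continuous_on.
End grid.

(** * Invariance of Lebesgue measure on row vectors under [v |-> - v] *)

Section negation_invariance.
Context (R : realType).

Lemma measurable_oppv n : measurable_fun setT (fun v : 'rV[R]_n => - v).
Proof.
apply: measurable_matrixP => i j; rewrite (ord1 i).
under eq_fun do rewrite mxE.
by apply: measurableT_comp => //; exact: measurable_entry.
Qed.

Lemma ge0_integral_oppr (f : R -> \bar R) : measurable_fun setT f ->
  (forall x, 0 <= f x)%E ->
  (\int[@lebesgue_measure R]_x f (- x)%R = \int[@lebesgue_measure R]_x f x)%E.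
Proof.
move=> mf f0.
transitivity (\int[pushforward (@lebesgue_measure R)
    (-%R : measurableTypeR R -> measurableTypeR R)]_x f x)%E.
  by rewrite ge0_integral_pushforward//; exact: oppr_measurable.
by apply: eq_measure_integral => A mA _; exact: lebesgue_measureN.
Qed.

(** The induction follows the construction of [lebesgue_rV]: Tonelli separates the first coordinate,
    which is reflected by the one-dimensional invariance, and the rest by the induction
    hypothesis. *)
Lemma ge0_integral_lebesgue_rVN n (f : 'rV[R]_n -> \bar R) : measurable_fun setT f ->
  (forall x, 0 <= f x)%E ->
  (\int[lebesgue_rV n]_v f (- v)%R = \int[lebesgue_rV n]_v f v)%E.
Proof.
elim: n f => [|n IH] f mf f0.
  by apply: eq_integral => v _; congr f; apply/rowP => -[].
have consE (g : 'rV[R]_n.+1 -> \bar R) : measurable_fun setT g ->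
    (forall x, 0 <= g x)%E ->
    (\int[lebesgue_rV n.+1]_v g v =
     \int[@lebesgue_measure R]_x \int[lebesgue_rV n]_v g (rV_cons (x, v)))%E.
  move=> mg g0; rewrite /lebesgue_rV -/(@lebesgue_rV R n).
  have mgc : measurable_fun setT (g \o @rV_cons R n).
    exact: measurableT_comp mg (@measurable_rV_cons _ _).
  transitivity (\int[(@lebesgue_measure R \x lebesgue_rV n)%E]_z
      (g \o @rV_cons R n) z)%E.
    transitivity (\int[pushforward (@lebesgue_measure R \x lebesgue_rV n)%E
        (@rV_cons R n)]_v g v)%E.
      by [].
    by rewrite ge0_integral_pushforward//; exact: measurable_rV_cons.
  by rewrite fubini_tonelli1 => [||z] //; exact: g0.
rewrite !consE//; last exact: measurableT_comp mf (@measurable_oppv _).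
have mfc : measurable_fun setT (f \o @rV_cons R n).
  exact: measurableT_comp mf (@measurable_rV_cons _ _).
have consN (x : R) (v : 'rV[R]_n) : - rV_cons (x, v) = rV_cons (- x, - v).
  by apply/rowP => i; rewrite !mxE; case: unliftP => [k _|_] //=; rewrite mxE.
rewrite -[RHS]ge0_integral_oppr; last 2 first.
- by apply: (measurable_fun_fubini_tonelli_F (f \o @rV_cons R n)) => // z; exact: f0.
- by move=> x; exact: integral_ge0.
apply: eq_integral => x _.
rewrite -[RHS]IH; first by apply: eq_integral => v _; rewrite consN.
- exact: (measurableT_comp mfc (measurable_pair1 _)).
- by [].
Qed.

End negation_invariance.

(** * Integrals against a finite weight, and convergence in probability from expectations *)

Section weighted_integral.
Context d (Q : measurableType d) (R : realType).
Variables (kappa : {sigma_finite_measure set Q -> \bar R}) (W : Q -> R).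
Hypothesis mW : measurable_fun setT W.
Hypothesis W_ge0 : forall q, 0 <= W q.
Hypothesis W_fin : (\int[kappa]_q (W q)%:E < +oo)%E.

Lemma weight_integrable : kappa.-integrable setT (EFin \o W).
Proof.
apply/integrableP; split; first exact/measurable_EFinP.
by under eq_integral do rewrite /= ger0_norm//.
Qed.

Lemma weighted_integrable (f : Q -> R) (C : R) : measurable_fun setT f ->
  (forall q, `|f q| <= C) -> kappa.-integrable setT (EFin \o (fun q => f q * W q)).
Proof.
move=> mf fC.
apply: (@le_integrable _ _ _ _ _ _ _ (EFin \o (fun q => C * W q))) => //.
- by apply/measurable_EFinP; exact: measurable_funM.
- move=> q _ /=; rewrite lee_fin !normrM ler_wpM2r//.
  exact: le_trans (fC q) (ler_norm _).
- rewrite (_ : _ \o _ = (fun q => C%:E * (EFin \o W) q)%E)//.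
  apply: integrableZl => //; exact: weight_integrable.
Qed.

Lemma weighted_dist (f g h : Q -> R) (C : R) :
  measurable_fun setT f -> measurable_fun setT g -> measurable_fun setT h ->
  (forall q, `|f q| <= C) -> (forall q, `|g q| <= C) -> (forall q, `|h q| <= C) ->
  (forall q, `|f q - g q| <= h q) ->
  `|\int[kappa]_q (f q * W q) - \int[kappa]_q (g q * W q)|
    <= \int[kappa]_q (h q * W q).
Proof.
move=> mf mg mh fC gC hC fgh.
have jf := weighted_integrable mf fC.
have jg := weighted_integrable mg gC.
rewrite -RintegralB//.
have fgE : (fun q => f q * W q - g q * W q) = (fun q => (f q - g q) * W q).
  by apply/funext => q; rewrite mulrBl.
have mfg : measurable_fun setT (fun q => f q - g q) by exact: measurable_funB.
have bfg q : `|f q - g q| <= C + C by rewrite (le_trans (ler_normB _ _))// lerD.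
rewrite fgE; apply: le_trans (le_normr_Rintegral measurableT _) _.
  exact: weighted_integrable bfg.
apply: le_Rintegral => //.
- rewrite (_ : (fun q => _) = (fun q => `|f q - g q| * W q)); last first.
    by apply/funext => q; rewrite normrM (ger0_norm (W_ge0 q)).
  apply: (@weighted_integrable _ (C + C)) => [|q]; first exact: measurableT_comp.
  by rewrite normr_id.
- exact: weighted_integrable hC.
- by move=> q _; rewrite normrM (ger0_norm (W_ge0 q)) ler_wpM2r.
Qed.

Lemma weighted_le_cst (f : Q -> R) (C K : R) : measurable_fun setT f ->
  (forall q, `|f q| <= C) -> (forall q, f q <= K) ->
  \int[kappa]_q (f q * W q) <= K * \int[kappa]_q W q.
Proof.
move=> mf fC fK; rewrite -RintegralZl//; last exact: weight_integrable.
apply: le_Rintegral => //.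
- exact: weighted_integrable fC.
- by apply: (@weighted_integrable _ `|K|).
- by move=> q _; rewrite ler_wpM2r.
Qed.

Section random.
Context dT (T : measurableType dT) (P : probability T R).

Lemma measurable_weighted_Rintegral (phi : T * Q -> R) : measurable_fun setT phi ->
  (forall z, 0 <= phi z) ->
  measurable_fun setT (fun x => \int[kappa]_q (phi (x, q) * W q)).
Proof.
move=> mphi phi0; apply: (measurableT_comp (fine_measurable measurableT)).
apply: (measurable_fun_fubini_tonelli_F (fun z => (phi z * W z.2)%:E)).
  apply/measurable_EFinP; apply: measurable_funM => //.
  exact: measurableT_comp mW measurable_snd.
by move=> z; rewrite lee_fin mulr_ge0.
Qed.

Lemma weighted_Rintegral_bounded (phi : T * Q -> R) (C : R) :
  measurable_fun setT phi -> (forall z, 0 <= phi z) -> (forall z, `|phi z| <= C) ->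
  forall x, `|\int[kappa]_q (phi (x, q) * W q)| <= C * \int[kappa]_q W q.
Proof.
move=> mphi phi0 phiC x; rewrite ger0_norm; last first.
  by apply: Rintegral_ge0 => q _; rewrite mulr_ge0.
apply: weighted_le_cst => //; first exact: (measurableT_comp mphi (measurable_pair1 _)).
by move=> q; exact: le_trans (ler_norm _) (phiC _).
Qed.

(** After the exchange of integrals by Tonelli, the expectations tend to [0] for each [q] and are at
    most [C], so [C * W] dominates. No uniformity in [q] is involved. *)
Lemma weighted_L1_cvg (phi : nat -> T * Q -> R) (C : R) :
  (forall n, measurable_fun setT (phi n)) ->
  (forall n z, 0 <= phi n z <= C) ->
  (forall q, \int[P]_x phi n (x, q) @[n --> \oo] --> 0) ->
  \int[P]_x (\int[kappa]_q (phi n (x, q) * W q)) @[n --> \oo] --> 0.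
Proof.
move=> mphi phiC phi0.
have phi_ge0 n z : 0 <= phi n z by have /andP[] := phiC n z.
have phi_leC n z : `|phi n z| <= C.
  by rewrite ger0_norm//; have /andP[] := phiC n z.
have msec n q : measurable_fun setT (fun x => phi n (x, q)).
  exact: (measurableT_comp (mphi n) (measurable_pair2 _)).
have msec1 n x : measurable_fun setT (fun q => phi n (x, q)).
  exact: (measurableT_comp (mphi n) (measurable_pair1 _)).
pose psi n q := \int[P]_x phi n (x, q).
have psiE n q : (psi n q)%:E = (\int[P]_x (phi n (x, q))%:E)%E.
  rewrite fineK//; apply: integrable_fin_num => //.
  exact: (bounded_integrable C).
have psi_ge0 n q : 0 <= psi n q by apply: Rintegral_ge0.
have mpsi n : measurable_fun setT (psi n).
  apply: (measurableT_comp (fine_measurable measurableT)).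
  apply: (@measurable_fun_fubini_tonelli_G _ _ _ _ _ P (EFin \o phi n)) => //.
    exact/measurable_EFinP.
  by move=> z; rewrite lee_fin.
have psiC n q : `|psi n q| <= C.
  rewrite ger0_norm// -[leRHS](Rintegral_cstT P); apply: le_Rintegral => //.
  - exact: (bounded_integrable C).
  - exact: finite_measure_integrable_cst.
  - by move=> x _; exact: le_trans (ler_norm _) (phi_leC _ _).
have swap n : \int[P]_x (\int[kappa]_q (phi n (x, q) * W q)) =
    \int[kappa]_q (psi n q * W q).
  congr fine; transitivity (\int[P]_x \int[kappa]_q (phi n (x, q) * W q)%:E)%E.
    apply: eq_integral => x _; rewrite fineK//; apply: integrable_fin_num => //.
    exact: (@weighted_integrable _ C).
  rewrite (fubini_tonelli (fun z => (phi n z * W z.2)%:E)); last 2 first.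
  - apply/measurable_EFinP; apply: measurable_funM => //.
    exact: measurableT_comp mW measurable_snd.
  - by move=> z; rewrite lee_fin mulr_ge0.
  apply: eq_integral => q _ /=; under eq_integral do rewrite EFinM.
  rewrite ge0_integralZr//; first by rewrite EFinM psiE.
  - exact/measurable_EFinP.
  - by move=> x _; rewrite lee_fin.
  - by rewrite lee_fin.
rewrite (_ : (fun n => _) = (fun n => \int[kappa]_q (psi n q * W q))); last first.
  by apply/funext.
have mf_ n : measurable_fun setT (fun q => (psi n q * W q)%:E).
  by apply/measurable_EFinP; exact: measurable_funM.
have f_f : {ae kappa, forall q, setT q -> (psi n q * W q)%:E @[n --> \oo] --> 0%E}.
  apply: aeW => q _; apply: cvg_EFin; first exact: nearW.
  have cW : (fun=> W q) @ \oo --> W q by exact: cvg_cst.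
  by have := cvgM (phi0 q) cW; rewrite mul0r; exact.
have iCW : kappa.-integrable setT (EFin \o (fun q => C * W q)).
  by apply: (@weighted_integrable _ `|C|).
have f_g : {ae kappa, forall q n, setT q ->
    (`|(psi n q * W q)%:E| <= (EFin \o (fun q => C * W q)%R) q)%E}.
  by apply: aeW => q n _; rewrite lee_fin normrM (ger0_norm (W_ge0 q)) ler_wpM2r.
have [_ _ h] := dominated_convergence measurableT mf_ (measurable_cst _) f_f iCW f_g.
rewrite integral0 in h.
exact: (@fine_cvg _ _ _ _ _ 0 h).
Qed.

End random.
End weighted_integral.

(** The bound by [G n] is required only on events [B n] whose probability tends to [1], which leaves
    room for a comparison valid only when the estimate is close to its limit. *)
Lemma markov_cvg_in_probability d (T : measurableType d) (R : realType)
    (P : probability T R) (V : nat -> T -> R) (v : R) :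
  (forall n, measurable_fun setT (V n)) ->
  (forall eta : R, 0 < eta -> exists (B : nat -> set T) (G : nat -> T -> R),
    [/\ forall n, measurable (B n) /\ measurable_fun setT (G n),
        forall n, P.-integrable setT (EFin \o G n),
        forall n x, 0 <= G n x,
        forall n x, B n x -> `|V n x - v| <= G n x &
        P (~` B n) @[n --> \oo] --> 0%E /\
        \forall n \near \oo, \int[P]_x G n x <= eta]) ->
  cvg_in_probability P V v.
Proof.
move=> mV H eps eps0.
have mE n : measurable [set x | eps <= `|V n x - v|].
  rewrite -[X in measurable X]setTI; apply: measurable_fun_ler => //.
  by apply: measurableT_comp => //; exact: measurable_funB.
suff : fine (P [set x | eps <= `|V n x - v|]) @[n --> \oo] --> 0.
  move=> h; rewrite (_ : (fun n => _) =
    (fun n => (fine (P [set x | eps <= `|V n x - v|]))%:E)).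
    by apply: cvg_EFin => //; exact: nearW.
  by apply/funext => n; rewrite fineK// fin_num_measure.
apply/cvgrPdist_le => /= eta eta0.
(* Markov's inequality at level [eps] divides the expectation by [eps], leaving [eta / 2]; the other
   half pays for the complement of [B n]. *)
have [|B [G [mBG iG G0 BG [PB EG]]]] := H (eps * (eta / 2)).
  by rewrite mulr_gt0// divr_gt0.
have {}PB : fine (P (~` B n)) @[n --> \oo] --> 0 := @fine_cvg _ _ _ _ _ 0 PB.
have eta20 : 0 < eta / 2 by rewrite divr_gt0.
have /cvgrPdist_le/(_ _ eta20) /= PB2 : fine (P (~` B n)) @[n --> \oo] --> 0.
  exact: PB.
near=> n.
rewrite sub0r normrN ger0_norm ?fine_ge0//.
have [mB mG] := mBG n.
have mGe : measurable [set x | eps <= G n x].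
  by rewrite -[X in measurable X]setTI; exact: measurable_fun_ler.
have hP : fine (P (~` B n)) <= eta / 2.
  by near: n; apply: filterS PB2 => n; rewrite sub0r normrN; exact: le_trans (ler_norm _).
have hG : fine (P [set x | eps <= G n x]) <= eta / 2.
  rewrite -(ler_pM2l eps0); apply: le_trans (_ : \int[P]_x G n x <= _); last first.
    by near: n.
  rewrite -lee_fin EFinM fineK ?fin_num_measure//.
  rewrite [leRHS]fineK; last by apply: integrable_fin_num => //; exact: iG.
  have := @le_integral_abse _ _ _ P setT measurableT (EFin \o G n) eps
    ((measurable_EFinP _ _).2 mG) eps0.
  rewrite setTI (_ : [set x | _] = [set x | eps <= G n x]); last first.
    by apply/seteqP; split => x /=; rewrite lee_fin ger0_norm.
  by under eq_integral do rewrite /= ger0_norm//.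
rewrite [eta]splitr; apply: le_trans (lerD hP hG).
rewrite -lee_fin EFinD !fineK ?fin_num_measure//; last exact: measurableC.
apply: (@le_trans _ _ (P (~` B n `|` [set x | eps <= G n x]))); last first.
  by apply: measureU2 => //; exact: measurableC.
apply: le_measure; rewrite ?inE//; first by apply: measurableU => //; exact: measurableC.
move=> x /= epsV; have [Bx|] := pselect (B n x); last by left.
by right; exact: le_trans epsV (BG _ _ Bx).
Unshelve. all: by end_near. Qed.

(** The library has this sigma-finite structure, but its canonical instance on [\x]
    is shadowed by the one for products of finite measures. *)
Section sigma_finite_product.
Local Open Scope ereal_scope.
Context d1 d2 (T1 : measurableType d1) (T2 : measurableType d2) (R : realType).
Variables (m1 : {sigma_finite_measure set T1 -> \bar R})
  (m2 : {sigma_finite_measure set T2 -> \bar R}).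

Definition sigma_finite_product : set (T1 * T2)%type -> \bar R := m1 \x m2.

HB.instance Definition _ := Measure.on sigma_finite_product.

Let sigma_finite_product_sigma_finite : sigma_finite setT sigma_finite_product.
Proof.
have /sigma_finiteP[F [TF ndF Foo]] := sigma_finiteT m1.
have /sigma_finiteP[G [TG ndG Goo]] := sigma_finiteT m2.
exists (fun n => F n `*` G n).
  apply/seteqP; split => // -[x y] _.
  have [i _ Fx] : (\bigcup_k F k) x by rewrite -TF.
  have [j _ Gy] : (\bigcup_k G k) y by rewrite -TG.
  exists (maxn i j) => //; split.
    by move: Fx; apply/subsetPset/ndF/leq_maxl.
  by move: Gy; apply/subsetPset/ndG/leq_maxr.
move=> k; have [mF Fk] := Foo k; have [mG Gk] := Goo k.
split; first exact: measurableX.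
by rewrite /sigma_finite_product product_measure1E// lte_mul_pinfty// ge0_fin_numE.
Qed.

HB.instance Definition _ := Measure_isSigmaFinite.Build _ _ _ sigma_finite_product
  sigma_finite_product_sigma_finite.

End sigma_finite_product.

(** * The weight on []0, 1[] times the frequency space *)

Section product_weight.
Context (R : realType) (n : nat) (w : R -> R) (om : 'rV[R]_n -> R).
Hypotheses (mw : measurable_fun (`]0%R, 1%R[%classic : set R) w)
  (mom : measurable_fun setT om).
Hypotheses (w_gt0 : forall u : R, 0 < u < 1 -> 0 < w u) (om_gt0 : forall v, 0 < om v).
Hypotheses
  (w_int : (\int[@lebesgue_measure R]_(u in `]0%R, 1%R[) (w u)%:E < +oo)%E)
  (om_int : (\int[lebesgue_rV n]_v (om v)%:E < +oo)%E).

Definition kappa : {sigma_finite_measure set (measurableTypeR R * 'rV[R]_n)%type -> \bar R} :=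
  sigma_finite_product (@lebesgue_measure R) (@lebesgue_rV R n).

(** Nothing is known of [w] outside []0, 1[]; cutting it to [0] there turns the integral over the
    interval into one over the whole product space. *)
Definition weight (z : measurableTypeR R * 'rV[R]_n) : R :=
  (w \_ `]0%R, 1%R[) z.1 * om z.2.

Lemma patched_w_ge0 (u : R) : 0 <= (w \_ `]0%R, 1%R[) u.
Proof.
rewrite patchE; case: ifPn => //; rewrite inE/= in_itv/= => u01.
exact: ltW (w_gt0 u01).
Qed.

Lemma measurable_patched_w : measurable_fun setT (w \_ `]0%R, 1%R[ : R -> R).
Proof. exact/(measurable_restrictT _ _).1. Qed.

Lemma measurable_weight : measurable_fun setT weight.
Proof.
apply: measurable_funM.
  exact: (measurableT_comp measurable_patched_w measurable_fst).
exact: (measurableT_comp mom measurable_snd).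
Qed.

Lemma weight_ge0 z : 0 <= weight z.
Proof. by rewrite mulr_ge0 ?patched_w_ge0// ltW. Qed.

Lemma integral_weight_section (f : 'rV[R]_n -> R) (C u : R) : measurable_fun setT f ->
  (forall v, `|f v| <= C) ->
  (lebesgue_rV n).-integrable setT (EFin \o (fun v => f v * weight (u, v))).
Proof.
move=> mf fC; rewrite /weight /=; set a := (w \_ _) u.
rewrite (_ : _ \o _ = (fun v => a%:E * (EFin \o (fun v => f v * om v)%R) v)%E); last first.
  by apply/funext => v /=; rewrite -EFinM mulrCA.
apply: integrableZl => //; apply: (weighted_integrable (W := om)) mf fC => //.
by move=> v; exact: ltW.
Qed.

Lemma weight_fin : (\int[kappa]_z (weight z)%:E < +oo)%E.
Proof.
rewrite (fubini_tonelli1 (EFin \o weight)); last 2 first.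
- by apply/measurable_EFinP; exact: measurable_weight.
- by move=> z; rewrite lee_fin weight_ge0.
rewrite /fubini_F (_ : (fun x => _) = (fun u =>
    ((w \_ `]0%R, 1%R[) u)%:E * \int[lebesgue_rV n]_v (om v)%:E)%E); last first.
  apply/funext => u /=; rewrite -ge0_integralZl//.
  - by apply/measurable_EFinP.
  - by move=> v _; rewrite lee_fin ltW.
  - by rewrite lee_fin patched_w_ge0.
have om0 : (0 <= \int[lebesgue_rV n]_v (om v)%:E)%E.
  by apply: integral_ge0 => v _; rewrite lee_fin ltW.
rewrite ge0_integralZr//; last 2 first.
- by apply/measurable_EFinP; exact: measurable_patched_w.
- by move=> u _; rewrite lee_fin patched_w_ge0.
rewrite lte_mul_pinfty//.
- by apply: integral_ge0 => u _; rewrite lee_fin patched_w_ge0.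
- rewrite ge0_fin_numE.
    apply: le_lt_trans w_int; rewrite [leRHS]integral_mkcond le_eqVlt.
    by apply/orP; left; apply/eqP/eq_integral => u _; rewrite !patchE; case: ifP.
  by apply: integral_ge0 => u _; rewrite lee_fin patched_w_ge0.
Qed.

(** In the iterated integral each level applies [fine]; the inner integrals are finite, so nothing
    is lost and Tonelli applies. [G] is constrained only for [0 < u < 1] since the factorisation of
    the weight is available only there. *)
Lemma iterated_Rintegral (f : measurableTypeR R * 'rV[R]_n -> R) (C : R)
    (G : R -> 'rV[R]_n -> R) :
  measurable_fun setT f -> (forall z, 0 <= f z <= C) ->
  (forall u v, 0 < u < 1 -> G u v = f (u, v) * (w u * om v)) ->
  \int[@lebesgue_measure R]_(u in `]0, 1[) \int[lebesgue_rV n]_v G u v =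
  \int[kappa]_z (f z * weight z).
Proof.
move=> mf fC GE.
have f0 z : 0 <= f z by have /andP[] := fC z.
have bf z : `|f z| <= C by rewrite ger0_norm//; have /andP[] := fC z.
rewrite Rintegral_mkcond; congr fine.
rewrite (fubini_tonelli1 (fun z => (f z * weight z)%:E)); last 2 first.
- by apply/measurable_EFinP; apply: measurable_funM => //; exact: measurable_weight.
- by move=> z; rewrite lee_fin mulr_ge0// weight_ge0.
apply: eq_integral => u _; rewrite /fubini_F patchE; case: ifPn => [|u01]; last first.
  apply/esym; rewrite integral0_eq// => v _.
  by rewrite /weight /= patchE (negPf u01) mul0r mulr0.
rewrite inE/= in_itv/= => u01.
rewrite -[RHS]fineK; last first.
  apply: integrable_fin_num => //; apply: (@integral_weight_section _ C) => //.
  exact: (measurableT_comp mf (measurable_pair1 _)).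
congr (fine _)%:E; apply: eq_integral => v _.
by rewrite GE// /weight /= patchE ifT// inE/= in_itv.
Qed.

Hypothesis om_even : forall v, om v = om (- v).

Lemma Rintegral_weight_opp (f : measurableTypeR R * 'rV[R]_n -> R) :
  measurable_fun setT f -> (forall z, 0 <= f z) ->
  \int[kappa]_z (f (z.1, - z.2) * weight z) = \int[kappa]_z (f z * weight z).
Proof.
move=> mf f0; congr fine.
have mfw : measurable_fun setT (fun z => (f z * weight z)%:E).
  by apply/measurable_EFinP; apply: measurable_funM => //; exact: measurable_weight.
have mopp : measurable_fun setT
    (fun z : measurableTypeR R * 'rV[R]_n => (z.1, - z.2)).
  apply/measurable_fun_pairP; split; first exact: measurable_fst.
  exact: (measurableT_comp (@measurable_oppv R n) measurable_snd).
rewrite (fubini_tonelli1 (fun z : measurableTypeR R * 'rV[R]_n =>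
  (f (z.1, - z.2) * weight z)%:E)); last 2 first.
- apply/measurable_EFinP; apply: measurable_funM; last exact: measurable_weight.
  exact: measurableT_comp mf mopp.
- by move=> z; rewrite lee_fin mulr_ge0// weight_ge0.
rewrite (fubini_tonelli1 (fun z => (f z * weight z)%:E))//; last first.
  by move=> z; rewrite lee_fin mulr_ge0// weight_ge0.
apply: eq_integral => u _; rewrite /fubini_F.
rewrite -[RHS]ge0_integral_lebesgue_rVN; last 2 first.
- exact: (measurableT_comp mfw (measurable_pair1 _)).
- by move=> v; rewrite lee_fin mulr_ge0// weight_ge0.
by apply: eq_integral => v _; rewrite /weight /= -om_even.
Qed.

(** The cross term [2 A B] is odd in [v], so it does not contribute. *)
Lemma Rintegral_even_odd (A B : measurableTypeR R * 'rV[R]_n -> R) (C : R) :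
  measurable_fun setT A -> measurable_fun setT B ->
  (forall z, `|A z| <= C) -> (forall z, `|B z| <= C) ->
  (forall u v, A (u, - v) = A (u, v)) -> (forall u v, B (u, - v) = - B (u, v)) ->
  \int[kappa]_z ((A z + B z) ^+ 2 * weight z) =
  \int[kappa]_z ((A z ^+ 2 + B z ^+ 2) * weight z).
Proof.
move=> mA mB AC BC evA oddB.
have bsq (g : measurableTypeR R * 'rV[R]_n -> R) K : (forall z, `|g z| <= K) ->
    forall z, `|g z ^+ 2| <= K ^+ 2.
  by move=> gK z; rewrite normrX ler_pXn2r// nnegrE (le_trans (normr_ge0 _) (gK z)).
have bD z : `|A z + B z| <= C + C by rewrite (le_trans (ler_normD _ _))// lerD.
have bB z : `|A z - B z| <= C + C by rewrite (le_trans (ler_normB _ _))// lerD.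
have mD : measurable_fun setT (fun z => (A z + B z) ^+ 2).
  by apply: measurable_funX; exact: measurable_funD.
have mN : measurable_fun setT (fun z => (A z - B z) ^+ 2).
  by apply: measurable_funX; exact: measurable_funB.
have wi := weighted_integrable measurable_weight weight_ge0 weight_fin.
(* Reflection turns [A + B] into [A - B]. Twice the left side is thus the integral of
   [(A - B) ^ 2 + (A + B) ^ 2], where the cross terms cancel. *)
have reflect : \int[kappa]_z ((A z - B z) ^+ 2 * weight z) =
    \int[kappa]_z ((A z + B z) ^+ 2 * weight z).
  rewrite -(@Rintegral_weight_opp (fun z => (A z + B z) ^+ 2))//; last first.
    by move=> z; exact: sqr_ge0.
  by apply: eq_Rintegral => -[u v] _ /=; rewrite evA oddB.
apply: (@mulfI _ 2) => //; rewrite -[LHS]/(2 * _) mulr_natl mulr2n -{1}reflect.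
rewrite -RintegralD//; last 2 first.
- exact: wi mN (bsq _ _ bB).
- exact: wi mD (bsq _ _ bD).
rewrite -RintegralZl//; last first.
  apply: (wi _ (C ^+ 2 + C ^+ 2)).
    by apply: measurable_funD; exact: measurable_funX.
  by move=> z; rewrite (le_trans (ler_normD _ _))// lerD// bsq.
by apply: eq_Rintegral => z _; ring.
Qed.

End product_weight.

(** * Fourier terms of the statistic *)

Section terms.
Context (R : realType) (F : R -> probability nat R).

(** Outside [(0, 1)], where the weight vanishes, [u] is replaced by [1/2] so that
    generating functions are bounded and measurable on the whole line. *)
Definition clamp01 (u : R) : R := if 0 < u < 1 then u else 2^-1.

Lemma clamp01_itv u : 0 <= clamp01 u <= 1.
Proof.
rewrite /clamp01; case: ifPn => [/andP[? ?]|_]; first by rewrite !ltW.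
by rewrite invr_ge0 ler0n invf_le1// ler1n.
Qed.

Lemma clamp01_id u : 0 < u < 1 -> clamp01 u = u.
Proof. by rewrite /clamp01 => ->. Qed.

Lemma measurable_clamp01 : measurable_fun setT clamp01.
Proof.
apply: measurable_fun_ifT => //.
by apply: measurable_and; exact: measurable_fun_ltr.
Qed.

Definition pgf_residual (l : R) (y : nat) (u : R) : R :=
  clamp01 u ^+ y - pgf F l (clamp01 u).

(** Leaving [e] free treats the cosine and sine parts together; [e = 1] gives the bare residual. *)
Definition fourier_term n (e : R -> R) (l : R) (y : nat) (z : 'rV[R]_n)
    (q : measurableTypeR R * 'rV[R]_n) : R :=
  pgf_residual l y q.1 * e (dotv q.2 z).

Lemma pgf_residual_le1 l y u : `|pgf_residual l y u| <= 1.
Proof.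
have u01 := clamp01_itv u; have /andP[g0 g1] := pgf_ge0_le1 F l u01.
have /andP[u0 u1] := u01.
have := exprn_ge0 y u0; have := exprn_ile1 y u0 u1.
by rewrite /pgf_residual ler_norml => ? ?; apply/andP; split; lra.
Qed.

Lemma fourier_term_le1 n e l y (z : 'rV[R]_n) q : (forall r, `|e r| <= 1) ->
  `|fourier_term e l y z q| <= 1.
Proof. by move=> e1; rewrite normrM mulr_ile1// pgf_residual_le1. Qed.

Lemma dotvE n (a b : 'rV[R]_n) : dotv a b = \sum_i a 0 i * b 0 i.
Proof. by rewrite /dotv mxE; apply: eq_bigr => i _; rewrite mxE. Qed.

Lemma dotvC n (a b : 'rV[R]_n) : dotv a b = dotv b a.
Proof. by rewrite !dotvE; apply: eq_bigr => i _; rewrite mulrC. Qed.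

Lemma dotvNl n (a b : 'rV[R]_n) : dotv (- a) b = - dotv a b.
Proof. by rewrite /dotv mulNmx mxE. Qed.

Lemma measurable_dotv d (T : measurableType d) n (f g : T -> 'rV[R]_n) :
  measurable_fun setT f -> measurable_fun setT g ->
  measurable_fun setT (fun x => dotv (f x) (g x)).
Proof.
move=> mf mg; under eq_fun do rewrite dotvE.
apply: measurable_sum => i; apply: measurable_funM.
  exact: (measurableT_comp (measurable_entry _ _) mf).
exact: (measurableT_comp (measurable_entry _ _) mg).
Qed.

Lemma measurable_fourier_term d (T : measurableType d) n e
    (L : T -> R) (Y : T -> nat) (Z : T -> 'rV[R]_n)
    (q : T -> measurableTypeR R * 'rV[R]_n) :
  stochastic_order F -> measurable_fun setT e ->
  measurable_fun setT L -> (forall x, 0 < L x) ->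
  measurable_fun setT Y -> measurable_fun setT Z -> measurable_fun setT q ->
  measurable_fun setT (fun x => fourier_term e (L x) (Y x) (Z x) (q x)).
Proof.
move=> F_order me mL L0 mY mZ /measurable_fun_pairP[mq1 mq2].
have mu : measurable_fun setT (fun x => clamp01 (q x).1).
  exact: measurableT_comp measurable_clamp01 mq1.
apply: measurable_funM; last first.
  by apply: (measurableT_comp me); exact: measurable_dotv.
apply: measurable_funB.
  (* Base and exponent are both random. Splitting by the value of the exponent gives partial sums
     that are constant once [N] exceeds [Y x]. *)
  apply: (@measurable_fun_cvg _ _ _ _ (fun N x => \sum_(k < N)
      clamp01 (q x).1 ^+ k * \1_[set x | Y x = k] x)).
    move=> N; apply: measurable_sum => k; apply: measurable_funM.
      exact: measurable_funX.
    apply: measurable_indic.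
    by have := mY measurableT [set (k : nat)] I; rewrite setTI.
  move=> x _; apply: cvg_near_cst; near=> N.
  have yN : (Y x < N)%N by near: N; exact: nbhs_infty_gt.
  rewrite (bigD1 (Ordinal yN))//= indicE mem_set// mulr1 big1 ?addr0// => k kY.
  rewrite indicE memNset ?mulr0// => /= Yk; move: kY; rewrite -val_eqE /= Yk.
  by rewrite eqxx.
rewrite (_ : (fun x => _) = (fun x => pgf F (L x) `|clamp01 (q x).1|)).
  exact: measurable_pgf.
apply/funext => x; rewrite ger0_norm//.
by have /andP[] := clamp01_itv (q x).1.
Unshelve. all: by end_near. Qed.

Lemma normc_D_stat p m K (h : link R p m K) init y xi theta N u v :
  Normc.normc (@D_stat R p m K h F init y xi theta N u v) ^+ 2 =
  (N%:R^-1 * \sum_(i < N) eps_hat h F init y xi theta i.+1%:Z u *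
     cos (dotv v (Z_hat p init y xi i.+1%:Z))) ^+ 2 +
  (N%:R^-1 * \sum_(i < N) eps_hat h F init y xi theta i.+1%:Z u *
     sin (dotv v (Z_hat p init y xi i.+1%:Z))) ^+ 2.
Proof.
rewrite /D_stat big_add1 /= big_mkord.
have -> (a b c : 'I_N -> R) :
    (\sum_(i < N) (a i)%:C * (b i +i* c i))%C =
    ((\sum_(i < N) a i * b i) +i* (\sum_(i < N) a i * c i))%C.
  elim/big_ind3 : _ => // [x1 x2 x3 y1 y2 y3 -> -> //|i _].
  by apply/eqP; rewrite eq_complex /= !mul0r subr0 addr0 !eqxx.
rewrite /Normc.normc /= !mul0r subr0 addr0 sqr_sqrtr// addr_ge0// sqr_ge0//.
Qed.

End terms.

(** * Measurability of lags and links, and continuity of the link in the parameter *)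

Section measurable_vectors.
Context d (T : measurableType d) (R : realType).

Lemma measurable_natr (f : T -> nat) : measurable_fun setT f ->
  measurable_fun setT (fun x => (f x)%:R : R).
Proof.
move=> mf; rewrite (_ : (fun x => _) = (fun k : nat => k%:R : R) \o f)//.
exact: measurableT_comp mf.
Qed.

Lemma measurable_lags p (z : T -> int -> R) t :
  (forall s, measurable_fun setT (fun x => z x s)) ->
  measurable_fun setT (fun x => lags p (z x) t).
Proof.
move=> mz; apply: measurable_matrixP => i j.
under eq_fun do rewrite mxE.
exact: mz.
Qed.

Lemma measurable_row_mx p m (A : T -> 'rV[R]_p) (B : T -> 'rV[R]_m) :
  measurable_fun setT A -> measurable_fun setT B ->
  measurable_fun setT (fun x => row_mx (A x) (B x)).
Proof.
move=> mA mB; apply: measurable_matrixP => i j; under eq_fun do rewrite mxE.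
case: (fintype.split j) => k; first exact: (measurableT_comp (measurable_entry i k) mA).
exact: (measurableT_comp (measurable_entry i k) mB).
Qed.

(** The parameter [Th] may be random, so that one lemma covers both the fixed [theta0] and the
    estimate. The summands are treated separately, as [r0] alone is confined to the orthant. *)
Lemma measurable_additive_link p m K (h0 : link R p m K)
    (r0 : 'rV[R]_p -> 'rV[R]_K -> R) (pi0 : 'rV[R]_m -> 'rV[R]_K -> R)
    (A : T -> 'rV[R]_p) (B : T -> 'rV[R]_m) (Th : T -> 'rV[R]_K) :
  (forall y x theta, nonneg_rV y -> h0 y x theta = r0 y theta + pi0 x theta) ->
  {within [set z : 'rV[R]_p * 'rV[R]_K | nonneg_rV z.1],
    continuous (fun z : 'rV[R]_p * 'rV[R]_K => r0 z.1 z.2)} ->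
  continuous (fun z : 'rV[R]_m * 'rV[R]_K => pi0 z.1 z.2) ->
  measurable_fun setT A -> measurable_fun setT B -> measurable_fun setT Th ->
  (forall x, nonneg_rV (A x)) ->
  measurable_fun setT (fun x => h0 (A x) (B x) (Th x)).
Proof.
move=> h0E r0_cont pi0_cont mA mB mTh A0.
rewrite (_ : (fun x => _) = (fun x => r0 (A x) (Th x) + pi0 (B x) (Th x))).
  apply: measurable_funD.
    apply: (@measurable_continuous_comp R p K r0 (@nonneg_rV R p)) => // N z.
    exact: grid_nonneg.
  by apply: (@measurable_continuous_comp R m K pi0 setT) => //; exact: continuous_subspaceT.
by apply/funext => x; rewrite h0E.
Qed.

End measurable_vectors.

Lemma measurable_norm_subl d (T : measurableType d) (R : realType) K
    (Th : T -> 'rV[R]_K) (theta0 : 'rV[R]_K) :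
  measurable_fun setT Th -> measurable_fun setT (fun x => `|Th x - theta0|).
Proof.
move=> mTh.
(* The second argument is a dummy in the zero-dimensional space. *)
apply: (@measurable_continuous_comp R K 0 (fun a _ => `|a - theta0|) setT) => //.
  apply: continuous_subspaceT => z; apply: cvg_norm; apply: cvgB; last exact: cvg_cst.
  exact: cvg_fst.
exact: measurable_cst (0 : 'rV[R]_0).
Qed.

Section uniform_continuity_in_theta.
Context (R : realType) (p m K : nat) (h0 : link R p m K).
Context (r0 : 'rV[R]_p -> 'rV[R]_K -> R) (pi0 : 'rV[R]_m -> 'rV[R]_K -> R).
Hypothesis h0E : forall y x theta, nonneg_rV y -> h0 y x theta = r0 y theta + pi0 x theta.
Hypothesis r0_cont : {within [set z : 'rV[R]_p * 'rV[R]_K | nonneg_rV z.1],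
  continuous (fun z : 'rV[R]_p * 'rV[R]_K => r0 z.1 z.2)}.
Hypothesis pi0_cont : continuous (fun z : 'rV[R]_m * 'rV[R]_K => pi0 z.1 z.2).

(** Each summand takes half of [e], by compactness of the boxes [[0, M]^p] and [[-M, M]^m]. *)
Lemma link_uniform_continuity (M e : R) (theta0 : 'rV[R]_K) : 0 < e ->
  exists2 delta : R, 0 < delta & forall theta y (x : 'rV[R]_m), `|theta - theta0| < delta ->
    nonneg_rV y -> (forall i, y 0 i <= M) -> (forall j, `|x 0 j| <= M) ->
    `|h0 y x theta - h0 y x theta0| <= e.
Proof.
move=> e0; have e20 : 0 < e / 2 by rewrite divr_gt0.
pose Cr := [set v : 'rV[R]_p | forall i, `[0, M]%classic (v ord0 i)].
pose Cpi := [set v : 'rV[R]_m | forall i, `[- M, M]%classic (v ord0 i)].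
have cr : compact Cr.
  by apply: (@rV_compact R p (fun=> `[0, M]%classic)) => i; exact: segment_compact.
have cpi : compact Cpi.
  by apply: (@rV_compact R m (fun=> `[- M, M]%classic)) => i; exact: segment_compact.
have hr := @compact_uniform_continuity R p K r0 (@nonneg_rV R p) r0_cont _ theta0 _ cr
  _ e20.
have hpi := @compact_uniform_continuity R m K pi0 setT
  (continuous_subspaceT pi0_cont) _ theta0 _ cpi (fun _ _ => I) e20.
have Cr0 : Cr `<=` @nonneg_rV R p.
  by move=> y yC i; have := yC i; rewrite /= in_itv/= => /andP[].
have : \forall theta \near theta0,
    (forall y, Cr y -> `|r0 y theta - r0 y theta0| <= e / 2) /\
    (forall x, Cpi x -> `|pi0 x theta - pi0 x theta0| <= e / 2).
  by apply: filterS2 hpi (hr Cr0) => theta h1 h2; split.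
move=> /nbhs_normP[delta /= delta0 H]; exists delta => // theta y x dth y0 yM xM.
have [|H1 H2] := H theta; first by rewrite /ball_/= distrC.
rewrite !h0E// opprD addrACA [e]splitr (le_trans (ler_normD _ _))// lerD//.
  by apply: H1 => i; rewrite /= in_itv/= y0 yM.
by apply: H2 => i; rewrite /= in_itv/= -ler_norml.
Qed.

End uniform_continuity_in_theta.

Lemma tail_probability_cvg0 d (T : measurableType d) (R : realType)
    (P : probability T R) (g : T -> R) (e : R) : measurable_fun setT g -> 0 < e ->
  exists M : R, (P [set x | (M < g x)%R] <= e%:E)%E.
Proof.
move=> mg e0; pose A n := [set x | n%:R < g x].
have mA n : measurable (A n).
  by rewrite -[X in measurable X]setTI; exact: measurable_fun_ltr.
have : P (A n) @[n --> \oo] --> P (\bigcap_n A n).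
  apply: nonincreasing_cvg_mu => //.
  - by rewrite [ltLHS](_ : _ = P (A 0%N))// -ge0_fin_numE// fin_num_measure.
  - exact: bigcapT_measurable.
  - move=> a b ab; apply/subsetPset => x; rewrite /A/= => /(le_lt_trans _); apply.
    by rewrite ler_nat.
rewrite (_ : \bigcap_n A n = set0); last first.
  apply/seteqP; split => // x /= h; have := h (Num.trunc (g x)).+1 I.
  by rewrite /A/= ltNge => /negP; apply; exact/ltW/truncnS_gt.
rewrite measure0 => h.
have {}h : fine (P (A n)) @[n --> \oo] --> 0 by exact: (@fine_cvg _ _ _ _ _ 0 h).
have /cvgrPdist_le/(_ _ e0) [N _ /(_ N (leqnn N))] := h.
rewrite /= sub0r normrN ger0_norm ?fine_ge0// => PAe; exists N%:R.
rewrite (_ : P _ = (fine (P (A N)))%:E) ?lee_fin//.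
by rewrite fineK// fin_num_measure//; exact: mA.
Qed.

Section information_field.
Context d (T : measurableType d) (R : realType) (m : nat).
Variables (Y : int -> T -> nat) (X : int -> T -> 'rV[R]_m) (t : int).

(** A second measurable structure on [T]: measurability with respect to the past becomes an instance
    of [measurable_fun], and the composition lemmas apply to it. *)
Definition information_type := g_sigma_algebraType [set C : set T |
  exists2 s, s <= t & exists2 A : set (nat * 'rV[R]_m), measurable A &
    C = [set x | A (Y s x, X s x)]].

Lemma measurable_information_pair s : s <= t ->
  measurable_fun setT ((fun x => (Y s x, X s x)) : information_type -> _).
Proof.
move=> st _ A mA; rewrite setTI; apply: sub_sigma_algebra.
by exists s => //; exists A.
Qed.

Lemma information_measurable : (forall s, measurable_fun setT (Y s)) ->
  (forall s, measurable_fun setT (X s)) -> forall B, information Y X t B -> measurable B.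
Proof.
move=> mY mX B; apply: smallest_sub; first exact: sigma_algebra_measurable.
move=> _ [s _ [A mA ->]].
have mYX : measurable_fun setT (fun x => (Y s x, X s x)).
  by apply/measurable_fun_pairP; split; [exact: mY|exact: mX].
by have := mYX measurableT A mA; rewrite setTI.
Qed.

End information_field.

Section trigonometric.
Context (R : realType).

Lemma measurable_cos : measurable_fun setT (cos : R -> R).
Proof. by apply: continuous_measurable_fun; exact: continuous_cos. Qed.

Lemma measurable_sin : measurable_fun setT (sin : R -> R).
Proof. by apply: continuous_measurable_fun; exact: continuous_sin. Qed.

Lemma normr_cos_le1 (r : R) : `|cos r| <= 1.
Proof. by rewrite ler_norml cos_geN1 cos_le1. Qed.

Lemma normr_sin_le1 (r : R) : `|sin r| <= 1.
Proof. by rewrite ler_norml sin_geN1 sin_le1. Qed.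

End trigonometric.

(** Adding [C] makes the integrand nonnegative, so that the measurability part of Tonelli
    applies. *)
Lemma measurable_Rintegral_param d (T : measurableType d) d' (Q : measurableType d')
    (R : realType) (P : probability T R) (phi : T * Q -> R) (C : R) :
  measurable_fun setT phi -> (forall z, `|phi z| <= C) ->
  measurable_fun setT (fun q => \int[P]_x phi (x, q)).
Proof.
move=> mphi phiC.
have msec q : measurable_fun setT (fun x => phi (x, q)).
  exact: (measurableT_comp mphi (measurable_pair2 _)).
rewrite (_ : (fun q => _) = (fun q => \int[P]_x (phi (x, q) + C) - C)); last first.
  apply/funext => q; rewrite RintegralD//; last 2 first.
  - exact: (bounded_integrable C).
  - exact: finite_measure_integrable_cst.
  by rewrite Rintegral_cstT addrK.
apply: measurable_funB => //; apply: (measurableT_comp (fine_measurable measurableT)).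
apply: (@measurable_fun_fubini_tonelli_G _ _ _ _ _ P (fun z => (phi z + C)%:E)).
  by apply/measurable_EFinP; exact: measurable_funD.
by move=> z; rewrite lee_fin -lerBlDr sub0r; have := phiC z; rewrite ler_norml => /andP[].
Qed.

Lemma sum_ltn_le p N : (\sum_(i < N) (i < p) <= p)%N.
Proof.
(* The bound by [p] alone is not inductive: a step with [N < p] adds [1]. *)
suff : (\sum_(i < N) (i < p) <= minn N p)%N by move/leq_trans; apply; exact: geq_minr.
elim: N => [|N IH]; first by rewrite big_ord0.
by rewrite big_ord_recr /=; move: (\sum_(i < N) _)%N IH => s; case: ltnP => /=; lia.
Qed.

(** * Averages along the stationary process and their limits *)

Section process.
Context (R : realType) (p m K : nat) (dT : measure_display) (T : measurableType dT).
Context (P : probability T R) (Y : int -> T -> nat) (X : int -> T -> 'rV[R]_m).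
Hypotheses (mY : forall t, measurable_fun setT (Y t))
  (mX : forall t, measurable_fun setT (X t)).
Context (F : R -> probability nat R) (F_order : stochastic_order F).

Section averages.
Variables (e : R -> R) (L : int -> T -> R) (Z : int -> T -> 'rV[R]_(p + m)).
Hypotheses (me : measurable_fun setT e) (e1 : forall r, `|e r| <= 1).

Definition fourier_average N (x : T) (q : measurableTypeR R * 'rV[R]_(p + m)) : R :=
  N%:R^-1 * \sum_(i < N)
    fourier_term F e (L i.+1%:Z x) (Y i.+1%:Z x) (Z i.+1%:Z x) q.

Lemma average_le1 N (f : 'I_N -> R) : (forall i, `|f i| <= 1) ->
  `|N%:R^-1 * \sum_i f i| <= 1.
Proof.
move=> f1; rewrite normrM; have [N0|N0] := posnP N.
  by rewrite [N in N%:R]N0 invr0 normr0 mul0r.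
rewrite normfV normr_nat ler_pdivrMl ?ltr0n// mulr1.
rewrite (le_trans (ler_norm_sum _ _ _))//.
by rewrite (le_trans (ler_sum _ (fun i _ => f1 i)))// sumr_const card_ord.
Qed.

Lemma fourier_average_le1 N x q : `|fourier_average N x q| <= 1.
Proof. by apply: average_le1 => i; exact: fourier_term_le1. Qed.

Hypotheses (mL : forall t, measurable_fun setT (L t)) (L_gt0 : forall t x, 0 < L t x)
  (mZ : forall t, measurable_fun setT (Z t)).

Lemma measurable_fourier_average N :
  measurable_fun setT (fun z => fourier_average N z.1 z.2).
Proof.
apply: measurable_funM => //; apply: measurable_sum => i.
have m1 d' (U : measurableType d') (g : T -> U) : measurable_fun setT g ->
    measurable_fun setT (fun z : T * (measurableTypeR R * 'rV[R]_(p + m)) => g z.1).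
  by move=> mg; exact: (measurableT_comp mg measurable_fst).
apply: (@measurable_fourier_term R F _ _ _ e (fun z => L _ z.1) (fun z => Y _ z.1)
  (fun z => Z _ z.1) snd) => //.
- exact: m1.
- exact: m1.
- exact: m1.
Qed.

Definition fourier_mean (q : measurableTypeR R * 'rV[R]_(p + m)) : R :=
  \int[P]_x fourier_term F e (L 1 x) (Y 1 x) (Z 1 x) q.

Let measurable_fourier_one : measurable_fun setT
  (fun z => fourier_term F e (L 1 z.1) (Y 1 z.1) (Z 1 z.1) z.2).
Proof.
have m1 d' (U : measurableType d') (g : T -> U) : measurable_fun setT g ->
    measurable_fun setT (fun z : T * (measurableTypeR R * 'rV[R]_(p + m)) => g z.1).
  by move=> mg; exact: (measurableT_comp mg measurable_fst).
apply: (@measurable_fourier_term R F _ _ _ e (fun z => L _ z.1) (fun z => Y _ z.1)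
  (fun z => Z _ z.1) snd) => //.
- exact: m1.
- exact: m1.
- exact: m1.
Qed.

Lemma fourier_one_integrable q : P.-integrable setT
  (EFin \o (fun x => fourier_term F e (L 1 x) (Y 1 x) (Z 1 x) q)).
Proof.
apply: (bounded_integrable 1) => [|x]; last exact: fourier_term_le1.
exact: (measurableT_comp measurable_fourier_one (measurable_pair2 q)).
Qed.

Lemma measurable_fourier_mean : measurable_fun setT fourier_mean.
Proof.
apply: (@measurable_Rintegral_param _ _ _ _ _ P
  (fun z => fourier_term F e (L 1 z.1) (Y 1 z.1) (Z 1 z.1) z.2) 1) => //.
by move=> z; exact: fourier_term_le1.
Qed.

Lemma fourier_mean_le1 q : `|fourier_mean q| <= 1.
Proof.
apply: le_trans (le_normr_Rintegral measurableT (fourier_one_integrable q)) _.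
rewrite -[leRHS](Rintegral_cstT P); apply: le_Rintegral => //.
- have /integrable_norm := fourier_one_integrable q; exact.
- exact: finite_measure_integrable_cst.
- by move=> x _; exact: fourier_term_le1.
Qed.

End averages.

Context (h0 : link R p m K) (r0 : 'rV[R]_p -> 'rV[R]_K -> R)
  (pi0 : 'rV[R]_m -> 'rV[R]_K -> R).
Hypothesis h0_gt0 : forall y x theta, nonneg_rV y -> 0 < h0 y x theta.
Hypothesis h0E : forall y x theta, nonneg_rV y -> h0 y x theta = r0 y theta + pi0 x theta.
Hypothesis r0_cont : {within [set z : 'rV[R]_p * 'rV[R]_K | nonneg_rV z.1],
  continuous (fun z : 'rV[R]_p * 'rV[R]_K => r0 z.1 z.2)}.
Hypothesis pi0_cont : continuous (fun z : 'rV[R]_m * 'rV[R]_K => pi0 z.1 z.2).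
Variable theta0 : 'rV[R]_K.

Definition stationary_lambda (t : int) (x : T) : R :=
  h0 (lags p (count_path R Y x) t) (X (t - 1) x) theta0.

Definition stationary_Z (t : int) (x : T) : 'rV[R]_(p + m) :=
  row_mx (lags p (count_path R Y x) t) (X (t - 1) x).

Lemma lags_count_nonneg t x : nonneg_rV (lags p (count_path R Y x) t).
Proof. by move=> i; rewrite mxE. Qed.

Lemma measurable_lags_count t :
  measurable_fun setT (fun x => lags p (count_path R Y x) t).
Proof. by apply: measurable_lags => s; exact: measurable_natr. Qed.

Lemma measurable_stationary_Z t : measurable_fun setT (stationary_Z t).
Proof. by apply: measurable_row_mx => //; exact: measurable_lags_count. Qed.

Lemma measurable_stationary_lambda t : measurable_fun setT (stationary_lambda t).
Proof.
apply: (measurable_additive_link (Th := fun=> theta0) h0E r0_cont pi0_cont) => //.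
- exact: measurable_lags_count.
- by move=> x; exact: lags_count_nonneg.
Qed.

Lemma stationary_lambda_gt0 t x : 0 < stationary_lambda t x.
Proof. exact/h0_gt0/lags_count_nonneg. Qed.

Section conditional_mean.
Variable lamA : int -> T -> R.
Hypotheses (mlamA : forall t, measurable_fun setT (lamA t))
  (lamA_gt0 : forall t x, 0 < lamA t x)
  (Y_law : forall t, conditional_law P (Y t) (information Y X (t - 1)) F (lamA t)).

(** At time [1] the regressors are [Y] at times at most [0] and [X] at time [0], so the
    trigonometric factor is measurable for the past, to which the residual at the true intensity is
    orthogonal. *)
Lemma conditional_mean_residual (e : R -> R) u v : measurable_fun setT e ->
  (forall r, `|e r| <= 1) ->
  \int[P]_x (pgf_residual F (lamA 1 x) (Y 1 x) u * e (dotv v (stationary_Z 1 x))) = 0.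
Proof.
move=> me e1.
have mYI s : s <= 1 - 1 -> measurable_fun setT (Y s : information_type Y X (1 - 1) -> nat).
  move=> st; by have /measurable_fun_pairP[] := @measurable_information_pair _ T R m Y X _ _ st.
have mXI s : s <= 1 - 1 ->
    measurable_fun setT (X s : information_type Y X (1 - 1) -> 'rV[R]_m).
  move=> st; by have /measurable_fun_pairP[] := @measurable_information_pair _ T R m Y X _ _ st.
have mZI : measurable_fun setT (stationary_Z 1 : information_type Y X (1 - 1) -> _).
  apply: measurable_row_mx; last exact: mXI.
  apply: measurable_matrixP => i j.
  rewrite (_ : (fun x => _) = (fun x => (Y (1 - j.+1%:Z) x)%:R)); last first.
    by apply/funext => x; rewrite mxE.
  by apply: measurable_natr; apply: mYI; lia.
have meI : measurable_fun setT
    ((fun x => e (dotv v (stationary_Z 1 x))) : information_type Y X (1 - 1) -> R).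
  by apply: (measurableT_comp me); apply: measurable_dotv.
have u01 := clamp01_itv u.
apply: (@Rintegral_orthogonal _ _ _ P (information Y X (1 - 1))) => //.
- by move=> B; exact: information_measurable.
- exact: (@measurableT _ (information_type Y X (1 - 1))).
(* The residual is the Fourier term with [e = 1] and a zero-dimensional regressor. *)
- rewrite (_ : (fun x => _) = (fun x => fourier_term F (fun=> 1) (lamA 1 x) (Y 1 x)
      (0 : 'rV[R]_0) ((u, 0) : measurableTypeR R * 'rV[R]_0))).
    exact: measurable_fourier_term.
  by apply/funext => x; rewrite /fourier_term mulr1.
- by move=> x; exact: pgf_residual_le1.
- move=> B GB; apply: (conditional_pgf F_order _ _ _ (Y_law 1)) => //.
  exact: information_measurable GB.
- move=> c; have := meI measurableT `]c, +oo[%classic (measurable_itv _).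
  rewrite setTI; rewrite (_ : _ @^-1` _ = [set x | c < e (dotv v (stationary_Z 1 x))])//.
  by apply/seteqP; split => x /=; rewrite in_itv/= andbT.
Qed.

(** Subtracting from each mean its vanishing analogue at [lamA] cancels [u ^ Y_1] and leaves the
    difference of generating functions; cosine and sine add up to [cas]. *)
Lemma zetaE (u : R) v : 0 < u < 1 ->
  zeta P h0 F Y lamA X theta0 u v =
  fourier_mean cos stationary_lambda stationary_Z (u, v) +
  fourier_mean sin stationary_lambda stationary_Z (u, v).
Proof.
move=> u01.
have [mcos msin] := (@measurable_cos R, @measurable_sin R).
have [cos1 sin1] := (@normr_cos_le1 R, @normr_sin_le1 R).
have key (e : R -> R) : measurable_fun setT e -> (forall r, `|e r| <= 1) ->
    fourier_mean e stationary_lambda stationary_Z (u, v) =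
    \int[P]_x (fourier_term F e (stationary_lambda 1 x) (Y 1 x) (stationary_Z 1 x) (u, v) -
      fourier_term F e (lamA 1 x) (Y 1 x) (stationary_Z 1 x) (u, v)).
  move=> me e1; rewrite RintegralB//; last 2 first.
  - apply: fourier_one_integrable => //.
    + exact: measurable_stationary_lambda.
    + by move=> *; exact: stationary_lambda_gt0.
    + exact: measurable_stationary_Z.
  - by apply: fourier_one_integrable => //; exact: measurable_stationary_Z.
  by rewrite [X in _ = _ - X]conditional_mean_residual// subr0.
have bint (e : R -> R) : measurable_fun setT e -> (forall r, `|e r| <= 1) -> P.-integrable setT
    (EFin \o (fun x =>
      fourier_term F e (stationary_lambda 1 x) (Y 1 x) (stationary_Z 1 x) (u, v) -
      fourier_term F e (lamA 1 x) (Y 1 x) (stationary_Z 1 x) (u, v))).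
  move=> me e1; apply: (@integrableB _ _ _ P setT measurableT
    (EFin \o (fun x => fourier_term F e (stationary_lambda 1 x) (Y 1 x)
      (stationary_Z 1 x) (u, v)))
    (EFin \o (fun x => fourier_term F e (lamA 1 x) (Y 1 x) (stationary_Z 1 x) (u, v)))).
  - apply: fourier_one_integrable => //.
    + exact: measurable_stationary_lambda.
    + by move=> *; exact: stationary_lambda_gt0.
    + exact: measurable_stationary_Z.
  - by apply: fourier_one_integrable => //; exact: measurable_stationary_Z.
rewrite !key// -RintegralD//; last 2 first.
- exact: bint.
- exact: bint.
rewrite /zeta unlock; congr fine; apply: eq_integral => x _.
congr EFin; rewrite /fourier_term /pgf_residual /= clamp01_id//.
rewrite /cas [dotv _ v]dotvC /stationary_Z /stationary_lambda subrr; ring.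
Qed.

End conditional_mean.

Section ergodic_limit.
Variable lamA : int -> T -> R.
Hypothesis mlamA : forall t, measurable_fun setT (lamA t).
Hypotheses (YlX_stat : strictly_stationary P (fun t x => (Y t x, lamA t x, X t x)))
  (YlX_erg : ergodic P (fun t x => (Y t x, lamA t x, X t x))).

Local Notation path := (path_space (nat * R * 'rV[R]_m)%type).
(** Regressors are read off the path as seen from time [1], so that the path shifted by [i] yields
    those of time [i.+1]. *)
Let path_lags (w : path) := lags p (fun s => (w s).1.1%:R : R) 1.
Let path_Z (w : path) := row_mx (path_lags w) (w 0).2.

Let measurable_path_Y t : measurable_fun setT (fun w : path => (w t).1.1).
Proof.
exact: (measurableT_comp measurable_fst (measurableT_comp measurable_fst
  (@measurable_coord _ (nat * R * 'rV[R]_m)%type t))).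
Qed.

Let measurable_path_X t : measurable_fun setT (fun w : path => (w t).2).
Proof.
exact: (measurableT_comp measurable_snd
  (@measurable_coord _ (nat * R * 'rV[R]_m)%type t)).
Qed.

Let measurable_path_lags : measurable_fun setT path_lags.
Proof. by apply: measurable_lags => s; apply: measurable_natr. Qed.

Let measurable_path_Z : measurable_fun setT path_Z.
Proof. by apply: measurable_row_mx. Qed.

Let measurable_process t : measurable_fun setT (fun x => (Y t x, lamA t x, X t x)).
Proof.
apply/measurable_fun_pairP; split; last exact: mX.
by apply/measurable_fun_pairP; split; [exact: mY|exact: mlamA].
Qed.

Let shifted_lags (i : nat) x :
  path_lags (fun t => (Y (t + i%:Z) x, lamA (t + i%:Z) x, X (t + i%:Z) x)) =
  lags p (count_path R Y x) i.+1%:Z.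
Proof.
apply/rowP => j; rewrite !mxE /count_path /=; congr (Y _ x)%:R; lia.
Qed.

Let shifted_Z (i : nat) x :
  path_Z (fun t => (Y (t + i%:Z) x, lamA (t + i%:Z) x, X (t + i%:Z) x)) =
  stationary_Z i.+1%:Z x.
Proof.
by rewrite /path_Z shifted_lags /stationary_Z /=; congr (row_mx _ (X _ x)); lia.
Qed.

Lemma fourier_average_cvg (e : R -> R) q : measurable_fun setT e ->
  (forall r, `|e r| <= 1) ->
  \int[P]_x `|fourier_average e stationary_lambda stationary_Z N x q -
              fourier_mean e stationary_lambda stationary_Z q| @[N --> \oo] --> 0.
Proof.
move=> me e1.
pose f (w : path) := fourier_term F e (h0 (path_lags w) (w 0).2 theta0)
  (w 1).1.1 (path_Z w) q.
have mf : measurable_fun setT f.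
  apply: measurable_fourier_term => //.
  - apply: (measurable_additive_link (Th := fun=> theta0) h0E r0_cont pi0_cont) => //.
    by move=> w i; rewrite mxE.
  - by move=> w; apply: h0_gt0 => i; rewrite mxE.
have fE (i : nat) x :
    f (fun t => (Y (t + i%:Z) x, lamA (t + i%:Z) x, X (t + i%:Z) x)) =
    fourier_term F e (stationary_lambda i.+1%:Z x) (Y i.+1%:Z x)
      (stationary_Z i.+1%:Z x) q.
  rewrite /f shifted_Z shifted_lags /stationary_lambda /=.
  congr (fourier_term F e (h0 _ (X _ x) theta0) (Y _ x) _ q); lia.
have f1 w : `|f w| <= 1 by exact: fourier_term_le1.
have := ergodic_average measurable_process YlX_stat YlX_erg mf f1.
apply: cvg_trans; apply: near_eq_cvg; apply: nearW => N.
apply: eq_Rintegral => x _; congr (`|_ * _ - _|).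
by apply: eq_bigr => i _; rewrite fE.
Qed.

(** It dominates every coordinate, so a bound on it places lags and covariates in the box of
    [link_uniform_continuity], and it is visibly measurable. *)
Definition sum_norm n (z : 'rV[R]_n) : R := \sum_i `|z 0 i|.

Lemma measurable_sum_norm d (U : measurableType d) n (Z : U -> 'rV[R]_n) :
  measurable_fun setT Z -> measurable_fun setT (fun x => sum_norm (Z x)).
Proof.
move=> mZ; apply: measurable_sum => i; apply: measurableT_comp => //.
exact: (measurableT_comp (measurable_entry _ _) mZ).
Qed.

Lemma tail_stationary (M : R) (i : nat) :
  P [set x | M < sum_norm (stationary_Z i.+1%:Z x)] =
  P [set x | M < sum_norm (stationary_Z 1 x)].
Proof.
pose A := [set w : path | M < sum_norm (path_Z w)].
have mA : measurable A.
  rewrite -[X in measurable X]setTI; apply: measurable_fun_ltr => //.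
  exact: measurable_sum_norm.
have AE j : [set x | M < sum_norm (stationary_Z j.+1%:Z x)] =
    [set x | A (fun t => (Y (t + j%:Z) x, lamA (t + j%:Z) x, X (t + j%:Z) x))].
  by apply/funext => x; rewrite /A/= shifted_Z.
have PE j := stationary_shift j YlX_stat mA.
by rewrite AE PE -(PE 0%N) -AE.
Qed.

End ergodic_limit.
End process.

(** * Effect of the estimate and of the initial values *)

Section estimated_parameter.
Context (R : realType) (p m K : nat) (dT : measure_display) (T : measurableType dT).
Context (Y : int -> T -> nat) (X : int -> T -> 'rV[R]_m).
Hypotheses (mY : forall t, measurable_fun setT (Y t))
  (mX : forall t, measurable_fun setT (X t)).
Context (F : R -> probability nat R).
Context (h0 : link R p m K) (r0 : 'rV[R]_p -> 'rV[R]_K -> R)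
  (pi0 : 'rV[R]_m -> 'rV[R]_K -> R).
Hypothesis h0_gt0 : forall y x theta, nonneg_rV y -> 0 < h0 y x theta.
Hypothesis h0E : forall y x theta, nonneg_rV y -> h0 y x theta = r0 y theta + pi0 x theta.
Hypothesis r0_cont : {within [set z : 'rV[R]_p * 'rV[R]_K | nonneg_rV z.1],
  continuous (fun z : 'rV[R]_p * 'rV[R]_K => r0 z.1 z.2)}.
Hypothesis pi0_cont : continuous (fun z : 'rV[R]_m * 'rV[R]_K => pi0 z.1 z.2).
Context (init : int -> R) (init_ge0 : forall t, t <= 0 -> 0 <= init t).
Context (Th : T -> 'rV[R]_K).

Definition estimated_lambda (t : int) (x : T) : R :=
  lambda_hat h0 init (Y ^~ x) (X ^~ x) (Th x) t.

Definition estimated_Z (t : int) (x : T) : 'rV[R]_(p + m) :=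
  Z_hat p init (Y ^~ x) (X ^~ x) t.

Lemma observed_nonneg t x : nonneg_rV (lags p (observed init (Y ^~ x)) t).
Proof.
move=> i; rewrite mxE /observed; case: ifPn => // h.
by apply: init_ge0; lia.
Qed.

Lemma measurable_observed t :
  measurable_fun setT (fun x => lags p (observed init (Y ^~ x)) t).
Proof.
apply: measurable_lags => s; rewrite /observed; have [_|_] := boolP (1 <= s).
  exact: measurable_natr.
exact: measurable_cst.
Qed.

Lemma measurable_estimated_Z t : measurable_fun setT (estimated_Z t).
Proof. by apply: measurable_row_mx => //; exact: measurable_observed. Qed.

Lemma measurable_estimated_lambda t : measurable_fun setT Th ->
  measurable_fun setT (estimated_lambda t).
Proof.
move=> mTh; apply: (measurable_additive_link h0E r0_cont pi0_cont) => //.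
- exact: measurable_observed.
- by move=> x; exact: observed_nonneg.
Qed.

Lemma estimated_lambda_gt0 t x : 0 < estimated_lambda t x.
Proof. exact/h0_gt0/observed_nonneg. Qed.

Lemma le_sum_norm n (z : 'rV[R]_n) i : `|z 0 i| <= sum_norm z.
Proof. by rewrite /sum_norm (bigD1 i)//= lerDl sumr_ge0. Qed.

Context (M1 : R) (theta0 : 'rV[R]_K).
Hypothesis M1_gt0 : 0 < M1.
Hypothesis pgf_lip : forall u : R, 0 <= u <= 1 -> forall l1 l2, 0 < l1 -> 0 < l2 ->
  `|pgf F l1 u - pgf F l2 u| <= M1 * `|l1 - l2|.

(** Only the first [p] terms involve the initial values. *)
Lemma estimated_term_dist (e : R -> R) (i : nat) x q (M eps : R) :
  (forall r, `|e r| <= 1) -> 0 <= eps ->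
  (forall y (x' : 'rV[R]_m), nonneg_rV y -> (forall k, y 0 k <= M) ->
    (forall j, `|x' 0 j| <= M) -> `|h0 y x' (Th x) - h0 y x' theta0| <= eps) ->
  `|fourier_term F e (estimated_lambda i.+1%:Z x) (Y i.+1%:Z x)
      (estimated_Z i.+1%:Z x) q -
    fourier_term F e (stationary_lambda Y X h0 theta0 i.+1%:Z x) (Y i.+1%:Z x)
      (stationary_Z p Y X i.+1%:Z x) q| <=
  2 * (i < p)%N%:R + M1 * eps +
    \1_[set x | M < sum_norm (stationary_Z p Y X i.+1%:Z x)] x.
Proof.
move=> e1 eps0 Hh.
have ind0 : 0 <= \1_[set x | M < sum_norm (stationary_Z p Y X i.+1%:Z x)] x :> R.
  by rewrite indicE.
have [ip|pi] := ltnP i p.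
  rewrite mulr1 (le_trans (ler_normB _ _))// -addrA ler_wpDr//.
    by rewrite addr_ge0// mulr_ge0// ltW.
  by rewrite (_ : 2 = 1 + 1)// lerD// fourier_term_le1.
rewrite mulr0 add0r.
(* For [i >= p] and [k < p] the time [i.+1 - k.+1] is at least [1], hence observed. *)
have lagsE : lags p (observed init (Y ^~ x)) i.+1%:Z =
    lags p (count_path R Y x) i.+1%:Z.
  apply/rowP => k; rewrite !mxE /observed ifT//.
  by have := ltn_ord k; lia.
have ZE : estimated_Z i.+1%:Z x = stationary_Z p Y X i.+1%:Z x.
  by rewrite /estimated_Z /Z_hat lagsE.
rewrite ZE /fourier_term /pgf_residual -mulrBl normrM.
rewrite opprB addrC addrA subrK.
have u01 := clamp01_itv q.1.
apply: (@le_trans _ _ `|pgf F (stationary_lambda Y X h0 theta0 i.+1%:Z x) (clamp01 q.1) -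
    pgf F (estimated_lambda i.+1%:Z x) (clamp01 q.1)|).
  by rewrite ler_piMr.
have nn : nonneg_rV (lags p (count_path R Y x) i.+1%:Z) by exact: lags_count_nonneg.
(* Outside the box only the trivial bound [1] on a difference of generating functions remains, and
   the indicator pays for it. *)
have [Mz|zM] := ltP M (sum_norm (stationary_Z p Y X i.+1%:Z x)).
  rewrite indicE mem_set// ler_wpDl//; first by rewrite mulr_ge0// ltW.
  have aux (a b : R) : 0 <= a <= 1 -> 0 <= b <= 1 -> `|a - b| <= 1.
    by move=> /andP[? ?] /andP[? ?]; rewrite ler_norml; apply/andP; split; lra.
  by apply: aux; exact: pgf_ge0_le1.
rewrite ler_wpDr//; apply: le_trans (pgf_lip u01 _ _) _.
- exact/h0_gt0.
- exact: estimated_lambda_gt0.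
rewrite ler_pM2l// distrC /estimated_lambda /lambda_hat lagsE; apply: Hh => //.
- move=> k; have := le_sum_norm (stationary_Z p Y X i.+1%:Z x) (lshift m k).
  by rewrite row_mxEl => h; exact: le_trans (ler_norm _) (le_trans h zM).
- move=> j; have := le_sum_norm (stationary_Z p Y X i.+1%:Z x) (rshift p j).
  by rewrite row_mxEr => h; exact: le_trans h zM.
Qed.

Definition tail_frequency (M : R) (N : nat) (x : T) : R :=
  N%:R^-1 * \sum_(i < N) \1_[set x | M < sum_norm (stationary_Z p Y X i.+1%:Z x)] x.

Lemma tail_frequency_ge0_le1 M N x : 0 <= tail_frequency M N x <= 1.
Proof.
have t0 : 0 <= tail_frequency M N x.
  by rewrite mulr_ge0 ?invr_ge0// sumr_ge0// => i _; rewrite indicE.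
rewrite t0 (le_trans (ler_norm _))//; apply: average_le1 => i.
exact: normr_indic.
Qed.

Lemma measurable_tail M t :
  measurable [set x | M < sum_norm (stationary_Z p Y X t x)].
Proof.
rewrite -[X in measurable X]setTI; apply: measurable_fun_ltr => //.
by apply: measurable_sum_norm; exact: measurable_stationary_Z.
Qed.

Lemma measurable_tail_frequency M N : measurable_fun setT (tail_frequency M N).
Proof.
apply: measurable_funM => //; apply: measurable_sum => i.
by apply: measurable_indic; exact: measurable_tail.
Qed.

(** Averaging the termwise bound leaves at most [p] initial terms of cost [2]. The right side does
    not mention [q], so integration against the weight only multiplies it by the total mass. *)
Lemma estimated_average_dist (e : R -> R) N x q (M eps : R) :
  (forall r, `|e r| <= 1) -> 0 <= eps ->
  (forall y (x' : 'rV[R]_m), nonneg_rV y -> (forall k, y 0 k <= M) ->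
    (forall j, `|x' 0 j| <= M) -> `|h0 y x' (Th x) - h0 y x' theta0| <= eps) ->
  `|fourier_average Y F e estimated_lambda estimated_Z N x q -
    fourier_average Y F e (stationary_lambda Y X h0 theta0) (stationary_Z p Y X) N x q|
  <= N%:R^-1 * (2 * p%:R) + M1 * eps + tail_frequency M N x.
Proof.
move=> e1 eps0 Hh.
rewrite /fourier_average -mulrBr -sumrB normrM ger0_norm ?invr_ge0//.
apply: (@le_trans _ _ (N%:R^-1 * \sum_(i < N) (2 * (i < p)%N%:R + M1 * eps +
    \1_[set x | M < sum_norm (stationary_Z p Y X i.+1%:Z x)] x))).
  rewrite ler_wpM2l ?invr_ge0// (le_trans (ler_norm_sum _ _ _))//.
  by apply: ler_sum => i _; exact: estimated_term_dist.
rewrite !big_split/= !mulrDr /tail_frequency !lerD//.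
  rewrite ler_wpM2l ?invr_ge0// -mulr_sumr ler_wpM2l//.
  by rewrite -natr_sum ler_nat sum_ltn_le.
rewrite sumr_const card_ord -[M1 * eps *+ N]mulr_natl.
have [->|N0] := posnP N; first by rewrite invr0 mul0r mulr_ge0// ltW.
by rewrite mulKf// pnatr_eq0 -lt0n.
Qed.

End estimated_parameter.

Lemma sqr_dist_le (R : realType) (a b : R) : `|a| <= 1 -> `|b| <= 1 ->
  `|a ^+ 2 - b ^+ 2| <= 2 * `|a - b|.
Proof.
move=> a1 b1; rewrite subr_sqr normrM mulrC ler_wpM2r//.
by rewrite (le_trans (ler_normD _ _))// (_ : 2 = 1 + 1)// lerD.
Qed.

(** Linearity of expectation and stationarity suffice: all [N] indicators have the same tail
    probability. *)
Lemma Rintegral_tail_frequency (R : realType) (p m : nat) (dT : measure_display)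
    (T : measurableType dT) (P : probability T R) (Y : int -> T -> nat)
    (X : int -> T -> 'rV[R]_m) (lamA : int -> T -> R) (M eps : R) (N : nat) :
  (forall t, measurable_fun setT (Y t)) -> (forall t, measurable_fun setT (X t)) ->
  (forall t, measurable_fun setT (lamA t)) ->
  strictly_stationary P (fun t x => (Y t x, lamA t x, X t x)) -> 0 <= eps ->
  (P [set x | (M < sum_norm (stationary_Z p Y X 1 x))%R] <= eps%:E)%E ->
  \int[P]_x tail_frequency p Y X M N x <= eps.
Proof.
move=> mY mX mlamA st eps0 PM; rewrite /tail_frequency.
have iind (i : 'I_N) : P.-integrable setT
    (EFin \o \1_[set x | M < sum_norm (stationary_Z p Y X i.+1%:Z x)]).
  by apply: integrable_indic; exact: measurable_tail.
have isum : P.-integrable setT (EFin \o (fun x => \sum_(i < N)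
    \1_[set x | M < sum_norm (stationary_Z p Y X i.+1%:Z x)] x)).
  apply: (bounded_integrable N%:R).
    by apply: measurable_sum => i; apply: measurable_indic; exact: measurable_tail.
  move=> x; rewrite (le_trans (ler_norm_sum _ _ _))//.
  by rewrite (le_trans (ler_sum _ (fun i _ => normr_indic _ _ _)))// sumr_const card_ord.
rewrite RintegralZl//.
have [->|N0] := posnP N; first by rewrite invr0 mul0r.
rewrite ler_pdivrMl ?ltr0n// -lee_fin fineK; last first.
  by apply: integrable_fin_num => //; exact: isum.
under eq_integral do rewrite -sumEFin.
rewrite integral_sum//.
apply: (@le_trans _ _ (\sum_(i < N) eps%:E)%E).
  apply: lee_sum => i _; rewrite integral_indic ?setIT//; last exact: measurable_tail.
  by move: PM; rewrite -(tail_stationary p st M i).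
by rewrite sumEFin lee_fin sumr_const card_ord mulr_natl.
Qed.

(** * Real arithmetic of the error bounds *)

Section error_budget.
Context (R : realFieldType).
Implicit Types a b c d e k m n s t x y : R.

Lemma sum_sqr_itv02 a b : 0 <= a <= 1 -> 0 <= b <= 1 -> 0 <= a + b <= 2.
Proof. by move=> /andP[? ?] /andP[? ?]; apply/andP; split; lra. Qed.

Lemma sqr_addr_le4 a b : `|a| <= 1 -> `|b| <= 1 -> (a + b) ^+ 2 <= 4.
Proof.
rewrite !ler_norml => /andP[? ?] /andP[? ?].
rewrite (_ : 4 = 2 ^+ 2); last by rewrite -natrX.
rewrite -[leLHS]ger0_norm ?sqr_ge0// normrX ler_pXn2r ?nnegrE// ler_norml.
by apply/andP; split; lra.
Qed.

Lemma average_bound_itv n a m t : 0 <= n <= 1 -> 0 <= a -> 0 <= m -> 0 <= t <= 1 ->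
  0 <= n * a + m + t <= a + m + 1.
Proof.
move=> /andP[n0 n1] a0 m0 /andP[t0 t1].
have ? : n * a <= a by rewrite ler_piMl.
have ? : 0 <= n * a by rewrite mulr_ge0.
by apply/andP; split; lra.
Qed.

Lemma error_bound_itv b c x y : 0 <= b <= c -> 0 <= x <= 2 -> 0 <= y <= 2 ->
  0 <= 4 * b + (2 * x + 2 * y) <= 4 * c + 8.
Proof. by move=> /andP[? ?] /andP[? ?] /andP[? ?]; apply/andP; split; lra. Qed.

Lemma normr_le_error_bound a b c : 0 <= a <= 2 -> 0 <= b <= c -> `|a| <= 4 * c + 8.
Proof. by move=> /andP[? ?] /andP[? ?]; rewrite ger0_norm//; lra. Qed.

Lemma add_errors a b c x y : a <= 2 * (c + x) -> b <= 2 * (c + y) ->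
  a + b <= 4 * c + (2 * x + 2 * y).
Proof. by move=> ? ?; lra. Qed.

(** The left side is [e / 4] times [c / (c + 1)]; dividing by [c + 1] rather than [c] covers
    [c = 0]. *)
Lemma budget_share c e m : 0 <= c -> 0 < e -> 0 < m ->
  4 * c * (m * (e / (16 * (c + 1) * m))) <= e / 4.
Proof.
move=> c0 e0 m0; have c10 : 0 < c + 1 by rewrite ltr_wpDl.
rewrite (_ : 4 * c * _ = e / 4 * (c / (c + 1))); last by field; rewrite !gt_eqF.
by rewrite ler_piMr ?divr_ge0 ?(ltW e0)// ler_pdivrMr// mul1r lerDl.
Qed.

(** Initial values, parameter error and tail get a quarter of [e] each; the two ergodic errors,
    doubled, share the last quarter. *)
Lemma total_budget c a s t x y e : 0 <= c -> 4 * c * a <= e / 4 -> 4 * c * s <= e / 4 ->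
  4 * c * t <= e / 4 -> x <= e / 16 -> y <= e / 16 ->
  4 * c * (a + s + t) + (2 * x + 2 * y) <= e.
Proof.
move=> _; rewrite [4 * c * (_ + t)]mulrDr [4 * c * (a + s)]mulrDr.
by move: (4 * c * a) (4 * c * s) (4 * c * t) => u v w *; lra.
Qed.

End error_budget.

(** * Convergence of the normalised statistic *)

Theorem theorem4p4 (R : realType) (p0 m K0 : nat)
  (p0_gt0 : (0 < p0)%N) (m_gt0 : (0 < m)%N) (K0_gt0 : (0 < K0)%N)
  (dT : measure_display) (T : measurableType dT) (P : probability T R)
  (Y : int -> T -> nat) (X : int -> T -> 'rV[R]_m)
  (mY : forall t, measurable_fun setT (Y t))
  (mX : forall t, measurable_fun setT (X t))
  (F : R -> probability nat R) (F_mean : has_mean_parameter F)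
  (h0 : link R p0 m K0) (r0 : 'rV[R]_p0 -> 'rV[R]_K0 -> R)
  (pi0 : 'rV[R]_m -> 'rV[R]_K0 -> R) (c_h : R) (c_h_gt0 : 0 < c_h)
  (h0_gt : forall y x theta, nonneg_rV y -> c_h < h0 y x theta)
  (h0E : forall y x theta, nonneg_rV y -> h0 y x theta = r0 y theta + pi0 x theta)
  (r0_gt0 : forall y theta, nonneg_rV y -> 0 < r0 y theta)
  (pi0_gt0 : forall x theta, 0 < pi0 x theta)
  (r0_cont : {within [set z : 'rV[R]_p0 * 'rV[R]_K0 | nonneg_rV z.1],
    continuous (fun z : 'rV[R]_p0 * 'rV[R]_K0 => r0 z.1 z.2)})
  (pi0_cont : continuous (fun z : 'rV[R]_m * 'rV[R]_K0 => pi0 z.1 z.2))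
  (Theta : set 'rV[R]_K0) (alpha : 'I_p0 -> R) (alpha_lt1 : \sum_i alpha i < 1)
  (r0_lip : forall theta y1 y2, Theta theta -> nonneg_rV y1 -> nonneg_rV y2 ->
    `|r0 y1 theta - r0 y2 theta| <= \sum_i alpha i * `|y1 0 i - y2 0 i|)
  (pA qA KA : nat) (pA_gt0 : (0 < pA)%N) (KA_gt0 : (0 < KA)%N)
  (hA : link R (pA + qA) m KA)
  (hA_gt0 : forall y x theta, nonneg_rV y -> 0 < hA y x theta)
  (ThetaA : set 'rV[R]_KA) (thetaA : 'rV[R]_KA)
  (ThetaA_compact : compact ThetaA) (thetaA_int : interior ThetaA thetaA)
  (X_stat : strictly_stationary P X) (X_erg : ergodic P X)
  (F_order : stochastic_order F)
  (lamA : int -> T -> R) (mlamA : forall t, measurable_fun setT (lamA t))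
  (lamA_gt0 : forall t x, 0 < lamA t x)
  (YlX_stat : strictly_stationary P (fun t x => (Y t x, lamA t x, X t x)))
  (YlX_erg : ergodic P (fun t x => (Y t x, lamA t x, X t x)))
  (Y_law : forall t, conditional_law P (Y t) (information Y X (t - 1)) F (lamA t))
  (lamAE : forall t, {ae P, forall x, lamA t x =
    hA (row_mx (lags pA (count_path R Y x) t) (lags qA (fun s => lamA s x) t))
       (X (t - 1) x) thetaA})
  (ZA_sq : forall t, (\int[P]_x ((enorm (row_mx
    (row_mx (lags pA (count_path R Y x) t) (lags qA (fun s => lamA s x) t))
    (X (t - 1) x))) ^+ 2)%:E < +oo)%E)
  (M1 : R) (M1_gt0 : 0 < M1)
  (pgf_derivable : forall u l : R, 0 <= u <= 1 -> 0 < l ->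
    derivable (fun l' => pgf F l' u) l 1)
  (pgf_derive : forall u l : R, 0 <= u <= 1 -> 0 < l ->
    `|derive1 (fun l' => pgf F l' u) l| < M1)
  (est : forall N, N.-tuple (nat * 'rV[R]_m) -> 'rV[R]_K0)
  (mest : forall N, measurable_fun setT (est N))
  (est_Theta : forall N z, Theta (est N z))
  (Theta0 : set 'rV[R]_K0) (theta0 : 'rV[R]_K0)
  (Theta0_compact : compact Theta0) (Theta0_sub : Theta0 `<=` Theta)
  (theta0_int : interior Theta0 theta0)
  (est_cvg : cvg_in_probability P (estimate est Y X) theta0)
  (W : R -> 'rV[R]_(p0 + m) -> R) (w : R -> R) (om : 'rV[R]_(p0 + m) -> R)
  (WE : forall (u : R) v, 0 < u < 1 -> W u v = w u * om v)
  (mw : measurable_fun (`]0%R, 1%R[%classic : set R) w) (mom : measurable_fun setT om)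
  (w_gt0 : forall u : R, 0 < u < 1 -> 0 < w u) (om_gt0 : forall v, 0 < om v)
  (om_even : forall v, om v = om (- v))
  (w_int : (0 < \int[@lebesgue_measure R]_(u in `]0%R, 1%R[) (w u)%:E < +oo)%E)
  (om_int : (0 < \int[lebesgue_rV (p0 + m)]_v (om v)%:E < +oo)%E)
  (V : set 'rV[R]_K0) (V_nbhs : nbhs theta0 V)
  (h0_derivable : forall y x theta, nonneg_rV y -> V theta ->
    theta_derivable h0 y x theta)
  (h0_sup : forall t, (\int[P]_x ereal_sup
    [set `|h0 (lags p0 (count_path R Y x) t) (X (t - 1) x) theta|%:E
      | theta in V] < +oo)%E)
  (dh0_sup : forall t, (\int[P]_x ereal_sup
    [set (enorm (theta_gradient h0 (lags p0 (count_path R Y x) t)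
            (X (t - 1) x) theta))%:E | theta in V] < +oo)%E)
  (init : int -> R) (init_ge0 : forall t, t <= 0 -> 0 <= init t) :
  cvg_in_probability P
    (fun N x => N%:R^-1 *
       Delta_stat h0 F init (Y ^~ x) (X ^~ x) (estimate est Y X N x) N W)
    (\int[@lebesgue_measure R]_(u in `]0, 1[)
       \int[lebesgue_rV (p0 + m)]_v
         (zeta P h0 F Y lamA X theta0 u v ^+ 2 * (w u * om v))).
Proof.
have h0_gt0 y x theta : nonneg_rV y -> 0 < h0 y x theta.
  by move=> /(h0_gt y x theta); exact: lt_trans.
have [_ w_fin] := andP w_int.
have [_ om_fin] := andP om_int.
have [mcos msin] := (@measurable_cos R, @measurable_sin R).
have [cos1 sin1] := (@normr_cos_le1 R, @normr_sin_le1 R).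
pose Q := (measurableTypeR R * 'rV[R]_(p0 + m))%type.
pose Th := estimate est Y X.
pose L := stationary_lambda Y X h0 theta0.
pose Z := stationary_Z p0 Y X.
pose hL N := estimated_lambda Y X h0 init (Th N).
pose hZ := estimated_Z p0 Y X init.
pose hat e N (z : T * Q) := fourier_average Y F e (hL N) hZ N z.1 z.2.
pose stat e N (z : T * Q) := fourier_average Y F e L Z N z.1 z.2.
pose lim e (q : Q) := fourier_mean P Y F e L Z q.
pose J (f : Q -> R) := \int[@kappa R (p0 + m)]_z (f z * weight w om z).
pose sqm N (z : T * Q) : R := hat cos N z ^+ 2 + hat sin N z ^+ 2.
have mW := measurable_weight mw mom.
have W0 := weight_ge0 w_gt0 om_gt0.
have Wfin := weight_fin mw mom w_gt0 om_gt0 w_fin om_fin.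
have mTh N : measurable_fun setT (Th N).
  apply: (measurableT_comp (mest N)); apply/measurable_fun_tnthP => i.
  rewrite (_ : _ \o _ = (fun x => (Y i.+1%:Z x, X i%:Z x))).
    by apply/measurable_fun_pairP; split; [exact: mY|exact: mX].
  by apply/funext => x /=; rewrite tnth_mktuple.
have mhL N t : measurable_fun setT (hL N t).
  exact: (measurable_estimated_lambda mY mX h0E r0_cont pi0_cont init_ge0 t (mTh N)).
have hL0 N t x : 0 < hL N t x.
  exact: (estimated_lambda_gt0 Y X h0_gt0 init_ge0).
have mhZ t : measurable_fun setT (hZ t) by exact: measurable_estimated_Z.
have mL t : measurable_fun setT (L t).
  exact: (measurable_stationary_lambda mY mX h0E r0_cont pi0_cont).
have L0 t x : 0 < L t x by exact: stationary_lambda_gt0.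
have mZ t : measurable_fun setT (Z t) by exact: measurable_stationary_Z.
have mhat (e : R -> R) N : measurable_fun setT e -> measurable_fun setT (hat e N).
  by move=> me; exact: (measurable_fourier_average mY F_order me (mhL N) (hL0 N) mhZ N).
have mstat (e : R -> R) N : measurable_fun setT e -> measurable_fun setT (stat e N).
  by move=> me; exact: (measurable_fourier_average mY F_order me mL L0 mZ N).
have mlim (e : R -> R) : measurable_fun setT e -> (forall r, `|e r| <= 1) ->
    measurable_fun setT (lim e).
  by move=> me e1; exact: (measurable_fourier_mean P mY F_order me e1 mL L0 mZ).
have hat1 (e : R -> R) N z : (forall r, `|e r| <= 1) -> `|hat e N z| <= 1.
  by move=> e1; exact: fourier_average_le1.
have stat1 (e : R -> R) N z : (forall r, `|e r| <= 1) -> `|stat e N z| <= 1.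
  by move=> e1; exact: fourier_average_le1.
have lim1 (e : R -> R) q : measurable_fun setT e -> (forall r, `|e r| <= 1) -> `|lim e q| <= 1.
  by move=> me e1; exact: (fourier_mean_le1 P mY F_order me e1 mL L0 mZ).
have sq1 (a : R) : `|a| <= 1 -> 0 <= a ^+ 2 <= 1.
  by move=> a1; rewrite sqr_ge0 -[a ^+ 2]ger0_norm ?sqr_ge0// normrX exprn_ile1.
have msqm N : measurable_fun setT (sqm N).
  by apply: measurable_funD; apply: measurable_funX; exact: mhat.
have S02 N z : 0 <= sqm N z <= 2.
  by apply: sum_sqr_itv02; apply: sq1; exact: hat1.
have mpair1 (x : T) : measurable_fun setT (fun q : Q => (x, q)) := measurable_pair1 x.
have mJ (phi : T * Q -> R) : measurable_fun setT phi -> (forall z, 0 <= phi z) ->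
    measurable_fun setT (fun x => J (fun q => phi (x, q))).
  move=> mphi phi0.
  exact: (@measurable_weighted_Rintegral _ _ _ (@kappa R (p0 + m)) _ mW W0 _ _ phi).
have JC (phi : T * Q -> R) C : measurable_fun setT phi -> (forall z, 0 <= phi z) ->
    (forall z, `|phi z| <= C) ->
    forall x, `|J (fun q => phi (x, q))| <= C * \int[@kappa R (p0 + m)]_z weight w om z.
  move=> mphi phi0 phiC.
  exact: (@weighted_Rintegral_bounded _ _ _ (@kappa R (p0 + m)) _ mW W0 Wfin _ _ phi C).
have VE : (fun N x => N%:R^-1 * Delta_stat h0 F init (Y ^~ x) (X ^~ x)
    (estimate est Y X N x) N W) = fun N x => J (fun q => sqm N (x, q)).
  apply/funext => N; apply/funext => x; rewrite /Delta_stat.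
  rewrite (iterated_Rintegral mw mom w_gt0 om_gt0 om_fin (f := fun q => sqm N (x, q))
    (C := 2)) => [|||u v u01].
  - rewrite -/(J _); have [N0|N0] := posnP N; last by rewrite mulKf// pnatr_eq0 -lt0n.
    (* For [N = 0] both sides vanish, since [0^-1] is [0]. *)
    rewrite [X in X%:R^-1]N0 invr0 mul0r /J.
    rewrite (_ : (fun z => _) = cst 0); first by rewrite Rintegral_cst// mul0r.
    apply/funext => q; rewrite /sqm /hat /fourier_average [in X in X%:R^-1]N0.
    by rewrite N0 invr0 !mul0r expr0n/= addr0 mul0r.
  - exact: (measurableT_comp (msqm N) (mpair1 x)).
  - by move=> q; exact: S02.
  rewrite WE// normc_D_stat; congr (_ * _); rewrite /sqm /hat /fourier_average.
  congr ((_ * _) ^+ 2 + (_ * _) ^+ 2); apply: eq_bigr => i _;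
    by rewrite /fourier_term /pgf_residual /= clamp01_id.
(* The cosine mean is even in [v] and the sine mean odd, so the square of their sum may be replaced
   by the sum of their squares. *)
have limE : \int[@lebesgue_measure R]_(u in `]0, 1[)
    \int[lebesgue_rV (p0 + m)]_v
      (zeta P h0 F Y lamA X theta0 u v ^+ 2 * (w u * om v)) =
    J (fun q => lim cos q ^+ 2 + lim sin q ^+ 2).
  rewrite (iterated_Rintegral mw mom w_gt0 om_gt0 om_fin
    (f := fun q => (lim cos q + lim sin q) ^+ 2) (C := 4)) => [|||u v u01].
  - rewrite /J (Rintegral_even_odd mw mom w_gt0 om_gt0 w_fin om_fin om_even
      (C := 1)) //.
    + exact: mlim.
    + exact: mlim.
    + by move=> q; exact: lim1.
    + by move=> q; exact: lim1.
    + move=> u v; apply: eq_Rintegral => x _.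
      by rewrite /fourier_term /= dotvNl cosN.
    + move=> u v; rewrite -mulN1r /lim /fourier_mean -RintegralZl//; last first.
        exact: (fourier_one_integrable P mY F_order msin sin1 mL L0 mZ).
      apply: eq_Rintegral => x _.
      by rewrite /fourier_term /= dotvNl sinN mulrN mulN1r.
  - by apply: measurable_funX; apply: measurable_funD; exact: mlim.
  - by move=> q; rewrite sqr_ge0/= sqr_addr_le4// lim1.
  by rewrite (zetaE mY mX F_order h0_gt0 h0E r0_cont pi0_cont theta0 mlamA lamA_gt0 Y_law).
rewrite VE limE; apply: markov_cvg_in_probability.
  move=> N; apply: (mJ (sqm N)) => // z.
  by have /andP[] := S02 N z.
move=> eta eta0.
pose c : R := \int[@kappa R (p0 + m)]_z weight w om z.
have c0 : 0 <= c by apply: Rintegral_ge0 => q _; exact: W0.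
have c10 : 0 < c + 1 by rewrite ltr_wpDl.
(* The averaged error enters the final bound multiplied by [4 * c], and the parameter error also by
   [M1]; with [eps1] and [eps2] so chosen each contribution is at most [eta / 4]. *)
pose eps1 := eta / (16 * (c + 1) * M1).
have eps10 : 0 < eps1 by rewrite divr_gt0// !mulr_gt0.
pose eps2 := eta / (16 * (c + 1)).
have eps20 : 0 < eps2 by rewrite divr_gt0// mulr_gt0.
have [M PM] := tail_probability_cvg0 P (measurable_sum_norm (mZ 1)) eps20.
have [delta delta0 Hdelta] :=
  link_uniform_continuity h0E r0_cont pi0_cont M theta0 eps10.
have pgf_lip u : 0 <= u <= 1 -> forall l1 l2 : R, 0 < l1 -> 0 < l2 ->
    `|pgf F l1 u - pgf F l2 u| <= M1 * `|l1 - l2|.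
  move=> u01; apply: pgf_lipschitz => l l0; first exact: pgf_derivable.
  exact: pgf_derive.
pose B N := [set x | `|Th N x - theta0| < delta].
pose tail := tail_frequency p0 Y X M.
pose b N x : R := N%:R^-1 * (2 * p0%:R) + M1 * eps1 + tail N x.
pose dst e N (z : T * Q) : R := `|stat e N z - lim e z.2|.
(* Passing to squares of numbers bounded by [1] costs a factor [2]. The cosine and sine parts each
   contribute [2 * b], and twice their own ergodic error. *)
pose h N (z : T * Q) : R := 4 * b N z.1 + (2 * dst cos N z + 2 * dst sin N z).
have mtail N : measurable_fun setT (tail N) by exact: measurable_tail_frequency.
have tail01 N x : 0 <= tail N x <= 1 by exact: tail_frequency_ge0_le1.
have mb N : measurable_fun setT (b N) by exact: measurable_funD.
have Ninv01 (N : nat) : 0 <= (N%:R^-1 : R) <= 1.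
  rewrite invr_ge0 ler0n/=; case: N => [|N]; first by rewrite invr0.
  by rewrite invf_le1// ler1n.
pose Cb : R := 2 * p0%:R + M1 * eps1 + 1.
have bb N x : 0 <= b N x <= Cb.
  apply: average_bound_itv; [exact: Ninv01|exact: mulr_ge0| |exact: tail01].
  by rewrite mulr_ge0// ltW.
have mdst (e : R -> R) N : measurable_fun setT e -> (forall r, `|e r| <= 1) ->
    measurable_fun setT (dst e N).
  move=> me e1; apply: measurableT_comp => //; apply: measurable_funB.
    exact: mstat.
  exact: (measurableT_comp (mlim _ me e1) measurable_snd).
have dst02 (e : R -> R) N z : measurable_fun setT e -> (forall r, `|e r| <= 1) ->
    0 <= dst e N z <= 2.
  move=> me e1; rewrite normr_ge0/= (le_trans (ler_normB _ _))// (_ : 2 = 1 + 1)//.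
  by rewrite lerD ?stat1 ?lim1.
have mh N : measurable_fun setT (h N).
  apply: measurable_funD; last first.
    by apply: measurable_funD; apply: measurable_funM => //; exact: mdst.
  by apply: measurable_funM => //; exact: (measurableT_comp (mb N) measurable_fst).
have hb N z : 0 <= h N z <= 4 * Cb + 8.
  by apply: error_bound_itv; [exact: bb|exact: dst02|exact: dst02].
have h0' N z : 0 <= h N z by have /andP[] := hb N z.
have hC N z : `|h N z| <= 4 * Cb + 8.
  by rewrite ger0_norm//; have /andP[] := hb N z.
have mG N : measurable_fun setT (fun x => J (fun q => h N (x, q))).
  exact: (mJ (h N)).
have GC N x : `|J (fun q => h N (x, q))| <= (4 * Cb + 8) * c.
  exact: (JC (h N)).
exists B, (fun N x => J (fun q => h N (x, q))); split.
- move=> N; split; last exact: mG.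
  rewrite -[X in measurable X]setTI; apply: measurable_fun_ltr => //.
  exact: measurable_norm_subl.
- by move=> N; exact: (bounded_integrable _ (mG N) (GC N)).
- by move=> N x; apply: Rintegral_ge0 => q _; rewrite mulr_ge0.
- move=> N x Bx; apply: (@weighted_dist _ _ _ _ _ mW W0 Wfin _ _ _ (4 * Cb + 8)).
  + exact: (measurableT_comp (msqm N) (mpair1 x)).
  + by apply: measurable_funD; apply: measurable_funX; exact: mlim.
  + exact: (measurableT_comp (mh N) (mpair1 x)).
  + by move=> q; exact: normr_le_error_bound (S02 N (x, q)) (bb N x).
  + move=> q; apply: normr_le_error_bound (bb N x).
    by apply: sum_sqr_itv02; apply: sq1; exact: lim1.
  + by move=> q; exact: hC.
  + move=> q; have near_e (e : R -> R) : measurable_fun setT e -> (forall r, `|e r| <= 1) ->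
        `|hat e N (x, q) ^+ 2 - lim e q ^+ 2| <= 2 * (b N x + dst e N (x, q)).
      move=> me e1; apply: le_trans (sqr_dist_le (hat1 _ _ _ e1) (lim1 _ _ me e1)) _.
      rewrite ler_pM2l// -(subrKA (stat e N (x, q))) (le_trans (ler_normD _ _))//.
      rewrite lerD2r.
      have Hh y (x' : 'rV[R]_m) : nonneg_rV y -> (forall k, y 0 k <= M) ->
          (forall j, `|x' 0 j| <= M) -> `|h0 y x' (Th N x) - h0 y x' theta0| <= eps1.
        by move=> y0 yM xM; exact: Hdelta.
      exact: (@estimated_average_dist R p0 m K0 dT T Y X F h0 h0_gt0 init init_ge0
        (Th N) M1 theta0 M1_gt0 pgf_lip e N x q M eps1 e1 (ltW eps10) Hh).
    rewrite /sqm opprD addrACA (le_trans (ler_normD _ _))//.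
    exact: add_errors (near_e _ mcos cos1) (near_e _ msin sin1).
split.
  rewrite (_ : (fun N => _) = (fun N => P [set x | delta <= `|Th N x - theta0|])).
    exact: est_cvg.
  apply/funext => N; congr (P _); apply/seteqP; split => x /=.
    by rewrite /B/= => /negP; rewrite -leNgt.
  by rewrite /B/= => dx; apply/negP; rewrite -leNgt.
pose Id e N x := J (fun q => dst e N (x, q)).
have iQ (f : Q -> R) C : measurable_fun setT f -> (forall q, `|f q| <= C) ->
    (@kappa R (p0 + m)).-integrable setT (EFin \o (fun q => f q * weight w om q)).
  exact: (weighted_integrable mW W0 Wfin).
have idst (e : R -> R) N x : measurable_fun setT e -> (forall r, `|e r| <= 1) ->
    (@kappa R (p0 + m)).-integrable setT (EFin \o (fun q => dst e N (x, q) * weight w om q)).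
  move=> me e1; apply: (iQ _ 2); first exact: (measurableT_comp (mdst _ _ me e1) (mpair1 x)).
  by move=> q; have /andP[d0 d2] := dst02 e N (x, q) me e1; rewrite ger0_norm.
have mId (e : R -> R) N : measurable_fun setT e -> (forall r, `|e r| <= 1) ->
    measurable_fun setT (Id e N).
  move=> me e1; apply: (mJ (dst e N)) => [|z]; first exact: mdst.
  by have /andP[] := dst02 e N z me e1.
have iId (e : R -> R) N : measurable_fun setT e -> (forall r, `|e r| <= 1) ->
    P.-integrable setT (EFin \o Id e N).
  move=> me e1; apply: (bounded_integrable (2 * c) (mId _ _ me e1)).
  apply: (JC (dst e N)) => [|z|z]; first exact: mdst.
    by have /andP[] := dst02 e N z me e1.
  by have /andP[d0 d2] := dst02 e N z me e1; rewrite ger0_norm.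
have Id0 (e : R -> R) : measurable_fun setT e -> (forall r, `|e r| <= 1) ->
    \int[P]_x Id e N x @[N --> \oo] --> 0.
  move=> me e1; apply: (weighted_L1_cvg mW W0 Wfin (phi := dst e) (C := 2)).
  - by move=> N; exact: mdst.
  - by move=> N z; exact: dst02.
  - move=> q; exact: (fourier_average_cvg mY mX F_order h0_gt0 h0E r0_cont pi0_cont
      theta0 mlamA YlX_stat YlX_erg q me e1).
(* As [b] is constant in [q], its integral only produces the total mass [c]. *)
have GE N x : J (fun q => h N (x, q)) = 4 * c * b N x + (2 * Id cos N x + 2 * Id sin N x).
  rewrite /J /h /=.
  rewrite (_ : (fun q => _) = (fun q => 4 * b N x * weight w om q +
    (2 * (dst cos N (x, q) * weight w om q) + 2 * (dst sin N (x, q) * weight w om q)))).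
    have iW := weight_integrable mW W0 Wfin.
    have i2 (e : R -> R) : measurable_fun setT e -> (forall r, `|e r| <= 1) ->
        (@kappa R (p0 + m)).-integrable setT
          (EFin \o (fun q => 2 * (dst e N (x, q) * weight w om q))).
      by move=> me e1; apply: (integrableZl measurableT 2 (idst e N x me e1)).
    rewrite RintegralD//; last 2 first.
    - exact: (integrableZl measurableT (4 * b N x) iW).
    - exact: (integrableD measurableT (i2 _ mcos cos1) (i2 _ msin sin1)).
    rewrite RintegralZl// RintegralD//; [|exact: i2|exact: i2].
    rewrite RintegralZl//; last exact: idst.
    rewrite RintegralZl//; last exact: idst.
    by rewrite -/c mulrAC.
  by apply/funext => q; ring.
have EId (e : R -> R) : measurable_fun setT e -> (forall r, `|e r| <= 1) ->
    \forall N \near \oo, \int[P]_x Id e N x <= eta / 16.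
  move=> me e1; have e160 : 0 < eta / 16 by rewrite divr_gt0.
  have /cvgrPdist_le/(_ _ e160) := Id0 e me e1; apply: filterS => N.
  by rewrite sub0r normrN; exact: le_trans (ler_norm _).
(* The [p0] terms affected by the initial values weigh [O(1 / N)] in the average. *)
have p0_near : \forall N \near \oo, 4 * c * (N%:R^-1 * (2 * p0%:R)) <= eta / 4.
  near=> N; have N0 : 0 < N%:R :> R by rewrite ltr0n; near: N; exact: nbhs_infty_gt.
  rewrite mulrCA mulrC ler_pdivrMr// -ler_pdivrMl ?divr_gt0//.
  by near: N; exact: nbhs_infty_ger.
have ib N : P.-integrable setT (EFin \o b N).
  apply: (bounded_integrable Cb (mb N)) => x.
  by have /andP[? ?] := bb N x; rewrite ger0_norm.
have Eb N : \int[P]_x b N x <= N%:R^-1 * (2 * p0%:R) + M1 * eps1 + eps2.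
  have it : P.-integrable setT (EFin \o tail N).
    apply: (bounded_integrable 1 (mtail N)) => x.
    by have /andP[? ?] := tail01 N x; rewrite ger0_norm.
  rewrite /b RintegralD//; last exact: finite_measure_integrable_cst.
  rewrite Rintegral_cstT lerD2l.
  by apply: (Rintegral_tail_frequency N mY mX mlamA YlX_stat (ltW eps20)); exact: PM.
apply: filterS3 p0_near (EId _ mcos cos1) (EId _ msin sin1) => N hN hc hs.
have h1 : 4 * c * (M1 * eps1) <= eta / 4 by exact: budget_share.
have h2 : 4 * c * eps2 <= eta / 4.
  by have := budget_share c0 eta0 ltr01; rewrite mulr1 mul1r.
rewrite (_ : (fun x => _) =
  (fun x => 4 * c * b N x + (2 * Id cos N x + 2 * Id sin N x))); last first.
  by apply/funext => x; exact: GE.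
have i2 (e : R -> R) : measurable_fun setT e -> (forall r, `|e r| <= 1) ->
    P.-integrable setT (EFin \o (fun x => 2 * Id e N x)).
  by move=> me e1; apply: (integrableZl measurableT 2 (iId e N me e1)).
rewrite RintegralD//; last 2 first.
- exact: (integrableZl measurableT (4 * c) (ib N)).
- exact: (integrableD measurableT (i2 _ mcos cos1) (i2 _ msin sin1)).
have bE : \int[P]_x (4 * c * b N x) = 4 * c * \int[P]_x b N x.
  by apply: RintegralZl => //; exact: ib.
have IdE (e : R -> R) : measurable_fun setT e -> (forall r, `|e r| <= 1) ->
    \int[P]_x (2 * Id e N x) = 2 * \int[P]_x Id e N x.
  by move=> me e1; apply: RintegralZl => //; exact: iId.
have sumE : \int[P]_x (2 * Id cos N x + 2 * Id sin N x) =
    \int[P]_x (2 * Id cos N x) + \int[P]_x (2 * Id sin N x).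
  by apply: RintegralD => //; exact: i2.
rewrite bE sumE !IdE//.
have hb' : 4 * c * \int[P]_x b N x <=
    4 * c * (N%:R^-1 * (2 * p0%:R) + M1 * eps1 + eps2).
  by rewrite ler_wpM2l// mulr_ge0.
apply: le_trans (lerD hb' (lexx _)) _.
exact: total_budget c0 hN h1 h2 hc hs.
Unshelve. all: by end_near. Qed.
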